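(* Let $k_{IJ}\ge 1$ be an integer, $w\in\mathbb{R}^N$, and suppose: (1) for each $\tilde w\in\Omega_w$ there is a solution $\hat\theta(\tilde w)$ of $G(\hat\theta(\tilde w),\tilde w)=0$ (one being fixed for each $\tilde w$), and $\Omega_\theta\subseteq\mathbb{R}^D$ is an open set which, for some $\epsilon>0$, contains every point at Euclidean distance less than $\epsilon$ from the convex hull of $\{\hat\theta(\tilde w):\tilde w\in\Omega_w\}$; (2) $g_0,\dots,g_N$ are $k_{IJ}+1$ times continuously differentiable on $\Omega_\theta$; (3) $H(\theta,1_N)$ is symmetric positive definite for all $\theta\in\Omega_\theta$ and $\sup_{\theta\in\Omega_\theta}\|H(\theta,1_N)^{-1}\|_{op}\le C_{op}<\infty$; (4) $\sup_{\theta\in\Omega_\theta}\|d_\theta^kG(\theta,1_N)\|_2\le M_k<\infty$ for $1\le k\le k_{IJ}+1$; (5) $\sup_{\tilde w\in\Omega_w}\sup_{\theta\in\Omega_\theta}\|d_\theta^kG(\theta,\tilde w)-d_\theta^kG(\theta,1_N)\|_2\le\delta_k$ for $0\le k\le k_{IJ}+1$; (6) $C_{op}\delta_1+C_{op}^2M_2\delta_0\le\rho$ for a fixed $\rho\in(0,1)$. Let $k$ be any integer in $1,\dots,k_{IJ}+1$. Then there exists a finite set of tuples $\mathscr{T}_k=\{(a_i,\mathbb{K}_i,\omega_i): i=1,\dots,|\mathscr{T}_k|\}$, where the $a_i$ are fixed scalars (not depending on $\tilde w$), the $\mathbb{K}_i$ are finite (possibly empty) multisets of positive integers and $\omega_i\in\{0,1\}$,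 such that for all $\tilde w\in\Omega_w$ $$\delta_w^k\hat\theta(\tilde w)=H(\tilde w)^{-1}\Big(\sum_{(a_i,\mathbb{K}_i,\omega_i)\in\mathscr{T}_k}a_i\,\tau(\mathbb{K}_i,\omega_i,\tilde w)\Big).$$ Furthermore, each tuple $(a_i,\mathbb{K}_i,\omega_i)\in\mathscr{T}_k$ satisfies $$\max_{k'\in\mathbb{K}_i}k'<k\qquad\text{and}\qquad\omega_i+\sum_{k'\in\mathbb{K}_i}k'=k,$$ where the first property is regarded as satisfied if $\mathbb{K}_i=\emptyset$, and an empty sum is $0$.
   Context: For $N,D\ge1$, functions $g_0,g_1,\dots,g_N$ with values in $\mathbb{R}^D$ of a variable $\theta\in\mathbb{R}^D$ (defined at least on $\Omega_\theta$), and $w\in\mathbb{R}^N$, set $G(\theta,w):=\frac1N\big(g_0(\theta)+\sum_{n=1}^Nw_ng_n(\theta)\big)$. $1_N$ is the all-ones vector of length $N$. $d_\theta^kG(\theta,w)$ is the array of the $D^{k+1}$ partial derivatives of order $k$ of $G$ in $\theta$, with $d_\theta^0G=G$ (similarly $d_\theta^kg_n(\theta)$), and $H(\theta,w):=d_\theta^1G(\theta,w)$. For $v_1,\dots,v_k\in\mathbb{R}^D$, $d_\theta^kG(\theta,w)v_1\cdots v_k\in\mathbb{R}^D$ is $\sum_{d_1,\dots,d_k}\frac{\partial^kG(\theta,w)}{\partial\theta_{d_1}\cdots\partial\theta_{d_k}}v_{1,d_1}\cdots v_{k,d_k}$. $\|\cdot\|_2$ of an array is the Euclidean norm of its vectorization;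 $\|\cdot\|_{op}$ is the matrix operator norm. For a fixed $w$ and a fixed (arbitrarily small) $\varepsilon>0$, $\Omega_w:=\{\tilde w\in\mathbb{R}^N:\|\tilde w-((1-t)1_N+tw)\|_2<\varepsilon\text{ for some }t\in[0,1]\}$. Write $\Delta w:=w-1_N$, $d_\theta^kG(\tilde w):=d_\theta^kG(\hat\theta(\tilde w),\tilde w)$ and $H(\tilde w):=H(\hat\theta(\tilde w),\tilde w)$. Under the listed hypotheses $H(\tilde w)$ is invertible and $\tilde w\mapsto\hat\theta(\tilde w)$ is $k_{IJ}+1$ times continuously differentiable on $\Omega_w$; its $k$-th directional derivative in the direction $\Delta w$ is $$\delta_w^k\hat\theta(\tilde w):=\sum_{n_1=1}^N\cdots\sum_{n_k=1}^N\frac{\partial^k\hat\theta(w')}{\partial w'_{n_1}\cdots\partial w'_{n_k}}\Big|_{w'=\tilde w}\Delta w_{n_1}\cdots\Delta w_{n_k}.$$ Set $\delta_wd^kG(\theta):=\frac1N\sum_{n=1}^Nd_\theta^kg_n(\theta)\Delta w_n=d_\theta^kG(\theta,w)-d_\theta^kG(\theta,1_N)$. For a finite multiset $\mathbb{K}$ of positive integers with $|\mathbb{K}|$ elements (counted with multiplicity), $\omega\in\{0,1\}$ and $\tilde w\in\Omega_w$, define $\tau(\mathbb{K},\omega,\tilde w)\in\mathbb{R}^D$ by $$\tau(\mathbb{K},0,\tilde w):=d_\theta^{|\mathbb{K}|}G(\tilde w)\prod_{k_i\in\mathbb{K}}\delta_w^{k_i}\hat\theta(\tilde w),\qquad\tau(\mathbb{K},1,\tilde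 w):=\delta_wd^{|\mathbb{K}|}G(\hat\theta(\tilde w))\prod_{k_i\in\mathbb{K}}\delta_w^{k_i}\hat\theta(\tilde w),$$ where the ''product'' means that the derivative array is applied to the vectors $\delta_w^{k_i}\hat\theta(\tilde w)$, $k_i\in\mathbb{K}$ (the order being irrelevant). *)

(* Defs.v *)
From HB Require Import structures.
From mathcomp Require Import all_boot all_order all_algebra.
From mathcomp Require Import finmap multiset.
From mathcomp Require Import all_classical all_reals all_analysis.
Set Implicit Arguments.
Unset Strict Implicit.
Unset Printing Implicit Defensive.
Import Order.TTheory GRing.Theory Num.Theory.
Import numFieldNormedType.Exports.
Local Open Scope mset_scope.
Local Open Scope classical_set_scope.
Local Open Scope ring_scope.

Section Euclid.
Context {R : realType}.

Definition enorm n (x : 'cV[R]_n) : R := Num.sqrt (\sum_(i < n) x i 0 ^+ 2).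

(* The library norm on matrices is the sup norm, hence the explicit Euclidean
   and operator norms. *)
Definition opnorm n (A : 'M[R]_n) : R :=
  sup [set enorm (A *m x) | x in [set x : 'cV[R]_n | enorm x <= 1]].

Definition symposdef n (A : 'M[R]_n) : Prop :=
  A^T = A /\ forall x : 'cV[R]_n, x != 0 -> 0 < (x^T *m A *m x) 0 0.

Definition convex_hull n (A : set 'cV[R]_n) : set 'cV[R]_n :=
  \bigcap_(C in [set C : set 'cV[R]_n | convex_set C /\ A `<=` C]) C.

End Euclid.

Section DerivativeArrays.
Context {R : realType}.
Implicit Types m n k : nat.

(* [pder [:: d_1; ...; d_k] f] is d^k f / dx_{d_1} ... dx_{d_k}, with d/dx_{d_k}
   applied first. *)
Definition pder m n (s : seq 'I_m) (f : 'cV[R]_m -> 'cV[R]_n) :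
    'cV[R]_m -> 'cV[R]_n :=
  foldr (fun d h x => 'D_(delta_mx d 0) h x) f s.

(* Each entry of the array is the vector of the n components of f, so the array
   has m ^ k * n scalar entries. *)
Definition darray m n k (f : 'cV[R]_m -> 'cV[R]_n) (x : 'cV[R]_m) :
    {ffun k.-tuple 'I_m -> 'cV[R]_n} :=
  [ffun s : k.-tuple 'I_m => pder s f x].

Definition array_norm m n k (A : {ffun k.-tuple 'I_m -> 'cV[R]_n}) : R :=
  Num.sqrt (\sum_(s : k.-tuple 'I_m) \sum_(i < n) A s i 0 ^+ 2).

Definition array_apply m n k (A : {ffun k.-tuple 'I_m -> 'cV[R]_n})
    (v : k.-tuple 'cV[R]_m) : 'cV[R]_n :=
  \sum_(s : k.-tuple 'I_m) (\prod_(i < k) tnth v i (tnth s i) 0) *: A s.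

Definition jacobian_mx m n (f : 'cV[R]_m -> 'cV[R]_n) (x : 'cV[R]_m) :
    'M[R]_(n, m) :=
  \matrix_(i, j) darray 1 f x [tuple j] i 0.

(* Intended for open [U]: outside of [U] nothing is required of [f], and the
   values of [pder s f] on [U] depend only on the restriction of [f] to [U]. *)
Definition Ck_on m n k (U : set 'cV[R]_m) (f : 'cV[R]_m -> 'cV[R]_n) : Prop :=
  forall s : seq 'I_m, (size s <= k)%N -> forall x, U x ->
    {for x, continuous (pder s f)} /\
    ((size s < k)%N -> forall d : 'I_m, derivable (pder s f) x (delta_mx d 0)).

End DerivativeArrays.

Section Estimator.
Context {R : realType} (N D : nat).
Variables (g0 : 'cV[R]_D -> 'cV[R]_D) (g : 'I_N -> 'cV[R]_D -> 'cV[R]_D).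
Implicit Types (w u : 'cV[R]_N) (theta : 'cV[R]_D).

Definition ones : 'cV[R]_N := const_mx 1.

Definition G theta w : 'cV[R]_D :=
  N%:R^-1 *: (g0 theta + \sum_(n < N) w n 0 *: g n theta).

Definition dG k theta w : {ffun k.-tuple 'I_D -> 'cV[R]_D} :=
  darray k (fun t => G t w) theta.

Definition H theta w : 'M[R]_D := jacobian_mx (fun t => G t w) theta.

Definition Omega_w (eps : R) w : set 'cV[R]_N :=
  [set u | exists t : R,
     0 <= t <= 1 /\ enorm (u - ((1 - t) *: ones + t *: w)) < eps].

(* From here on [w] is the reference weight vector, [u] the running one, and
   [that] the chosen solution map. *)
Variables (that : 'cV[R]_N -> 'cV[R]_D) (w : 'cV[R]_N).

Definition Delta : 'cV[R]_N := w - ones.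

Definition delta_that k u : 'cV[R]_D :=
  array_apply (darray k that u) [tuple of nseq k Delta].

Definition delta_dG k theta : {ffun k.-tuple 'I_D -> 'cV[R]_D} :=
  N%:R^-1 *: \sum_(n < N) Delta n 0 *: darray k (g n) theta.

(* Since [K] carries no order, the vectors are listed in the enumeration order
   of [enum_mset], with multiplicities; the partial derivatives commute where
   [tau] is used, so this choice does not matter. *)
Definition tau (K : {mset nat}) (omega : bool) u : 'cV[R]_D :=
  let v := map_tuple (fun k => delta_that k u) (in_tuple (enum_mset K)) in
  array_apply (if omega then delta_dG _ (that u) else dG _ (that u) u) v.

End Estimator.

(* Main.v *)
Require Import Defs.
From HB Require Import structures.
From mathcomp Require Import all_boot all_order all_algebra.
From mathcomp Require Import finmap multiset.
From mathcomp Require Import all_classical all_reals all_analysis.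
From mathcomp Require Import ring lra.
Set Implicit Arguments.
Unset Strict Implicit.
Unset Printing Implicit Defensive.
Import Order.TTheory GRing.Theory Num.Theory.
Import numFieldNormedType.Exports.
Local Open Scope mset_scope.
Local Open Scope fset_scope.
Local Open Scope classical_set_scope.
Local Open Scope ring_scope.

(** Writing L for the matrix H (that u) u, everything follows from one estimate:
    on Omega_theta the map theta |-> G theta u is strongly monotone, uniformly
    in u.  At the weights 1 the Jacobian is symmetric positive definite with
    inverse of norm at most Cop, so its quadratic form is at least |x|^2 / Cop
    (inverse_bound_coercive), and the Frobenius perturbation delta 1 costs only
    a factor 1 - rho (quadratic_perturbation).  Integrating along segments, a
    root y of G (., u) satisfies c |y - x| <= |G x u| whenever the segment from
    x to y stays in Omega_theta (root_distance).

    This a posteriori bound replaces the implicit function theorem, as the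
    existence of roots is given.  Testing it at x = that u, with the root
    y = that u' at a nearby weight u', gives continuity of the solution map.
    Testing it at x = that u + t p, where p = - L^-1 (N^-1 sum_n v_n g_n) is the
    expected derivative in the direction v, gives differentiability, because
    t |-> G (that u + t p) (u + t v) vanishes to first order at 0
    (is_derive_that).  The formula for p exhibits the first partial derivatives
    of the solution map as an expression in the map itself that loses one
    derivative of the g_n only, so that C^j regularity improves to C^(j+1) as
    long as j < kIJ + 1 (Ck_on_that).  Regularity is handled through scalar
    functions closed under sums, products, inverses and composition (smooth).

    The expansion is an induction on k (directional_expansion).  On Omega_w,
    L delta^k that = tau({k}, 0), and differentiating tau(K, omega) in the
    direction Delta produces tau(1 :: K, omega), the term tau(K, 1) when
    omega = 0, and all tau in which one entry of K is raised by one
    (is_derive_tau_seq).  Each of these operations raises omega + sum K by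
    exactly one.  Differentiating L delta^k that = sum_i a_i tau(K_i, omega_i)
    and solving for tau({k+1}, 0) gives the next expansion.  Multisets are
    first handled as lists, for which the Leibniz rule is a plain recursion;
    the order is forgotten at the end, since mixed partial derivatives commute
    (clairaut, pder_perm, perm_apply_seq). *)

(** * Derivatives along lines *)

Section Lines.
Context {R : realType} {V W : normedModType R}.

Lemma is_derive_line (f : V -> W) x v (t : R) :
  derivable f (t *: v + x) v ->
  is_derive t 1 (fun s => f (s *: v + x)) ('D_v f (t *: v + x)).
Proof.
have E : (fun h : R => h^-1 *: (((fun s => f (s *: v + x)) \o shift t) (h *: 1)
             - f (t *: v + x))) =
         (fun h : R => h^-1 *: ((f \o shift (t *: v + x)) (h *: v)
             - f (t *: v + x))).
  by apply/funext => h /=; rewrite [h *: 1]mulr1 scalerDl addrA.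
by move=> df; split; rewrite /derivable /derive E.
Qed.

(** Allows the mean value theorem, stated along a whole displacement, to be
    applied to a multiple of a basis vector. *)
Lemma is_derive_scaled_direction (f : V -> W) x v (a : R) :
  derivable f x v -> is_derive x (a *: v) f (a *: 'D_v f x).
Proof.
move=> df.
have dg : derivable (fun h : R => f (h *: v + x)) 0 1 by exact: (derivable1P f x v).1.
have Dv : 'D_1 (fun h : R => f (h *: v + x)) 0 = 'D_v f x.
  have := @is_derive_line f x v 0; rewrite scale0r add0r.
  by move=> /(_ df) /@derive_val.
move/derivable1_diffP: dg => dg.
have da : is_diff (0 : R) ( *:%R^~ a) ( *:%R^~ a : R -> R).
  exact: is_diff_scalel.
have dga : is_diff (0 : R^o) ((fun h : R => f (h *: v + x)) \o ( *:%R^~ a : R -> R))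
    ('d (fun h : R => f (h *: v + x)) (0 : R) \o ( *:%R^~ a : R -> R)).
  apply: is_diff_comp.
  by rewrite scale0r; exact: differentiableP.
have E : (fun h : R => f (h *: v + x)) \o ( *:%R^~ a : R -> R) =
         (fun h : R => f (h *: (a *: v) + x)).
  by apply/funext => h /=; rewrite scalerA.
rewrite E in dga.
have d1 : derivable f x (a *: v).
  by apply: (derivable1P _ _ _).2; apply/derivable1_diffP; exact: ex_diff.
split=> //.
have := @is_derive_line f x (a *: v) 0; rewrite scale0r add0r => /(_ d1) /@derive_val <-.
rewrite deriveE; last exact: ex_diff.
rewrite diff_val /= -Dv deriveE //.
by rewrite [1 *: a]mul1r -[in LHS](mulr1 a) linearZ.
Qed.

End Lines.

Lemma mvt_line {R : realType} {V : normedModType R} (f : V -> R) (x v : V) :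
  (forall t : R, 0 <= t <= 1 -> derivable f (t *: v + x) v) ->
  exists2 t : R, 0 <= t <= 1 & f (v + x) - f x = 'D_v f (t *: v + x).
Proof.
move=> df.
have [] := @MVT R (fun t => f (t *: v + x)) (fun t => 'D_v f (t *: v + x)) 0 1.
- exact: ltr01.
- by move=> t /[!in_itv]/= /andP[/ltW t0 /ltW t1]; apply/is_derive_line/df/andP.
- apply: derivable_within_continuous => t /[!in_itv]/= t01.
  by case: (is_derive_line (df t t01)).
move=> t /[!in_itv]/= /andP[/ltW t0 /ltW t1]; rewrite scale1r scale0r add0r subr0 mulr1.
by move=> E; exists t => //; apply/andP.
Qed.

(** Spares later proofs the Landau notation in which differentials are defined. *)
Lemma is_diff_linear_approx {R : realType} {V W : normedModType R} (f : V -> W) (x : V)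
    (L : {linear V -> W}) : continuous L ->
  (forall e : R, 0 < e -> \forall h \near (0 : V), `|f (h + x) - f x - L h| <= e * `|h|) ->
  is_diff x f L.
Proof.
move=> cL fL.
have E : f \o shift x = cst (f x) + L +o_ (0 : V) id.
  apply/eqaddoP => e e0; have := fL e e0; apply: filterS => h.
  by rewrite -addrA -opprD.
have dL := diff_unique cL E.
by apply: DiffDef => //; apply/diff_locallyP; rewrite dL.
Qed.

(** * Partial derivatives and differentiability *)

Section Coordinates.
Context {R : realType}.

Lemma coord_le_norm m n (h : 'M[R]_(m, n)) i j : `|h i j| <= `|h|.
Proof.
rewrite [leRHS]/Num.Def.normr/= mx_normrE.
exact: (le_bigmax _ (fun ij => `|h ij.1 ij.2|) (i, j)).
Qed.

Lemma norm_le_coord m n (h : 'M[R]_(m, n)) (b : R) :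
  0 <= b -> (forall i j, `|h i j| <= b) -> `|h| <= b.
Proof.
move=> b0 hb; rewrite [leLHS]/Num.Def.normr/= mx_normrE.
by apply: bigmax_le => // -[i j] _; exact: hb.
Qed.

Lemma derive_partials m (W : normedModType R) (f : 'cV[R]_m -> W) x v :
  differentiable f x ->
  'D_v f x = \sum_(d < m) v d 0 *: 'D_(delta_mx d 0) f x.
Proof.
move=> df; rewrite deriveE // [in LHS](matrix_sum_delta v) linear_sum.
apply: eq_bigr => d _; rewrite big_ord1 linearZ deriveE //.
Qed.

(** The increment of f along h is split into m increments, each moving a single
    coordinate; by the mean value theorem the d-th one is h_d times a partial
    derivative at a point close to x, hence close to the one at x. *)
Lemma continuous_partials_differentiable m (f : 'cV[R]_m -> R) (x : 'cV[R]_m) :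
  (\forall y \near x, forall d, derivable f y (delta_mx d 0)) ->
  (forall d, {for x, continuous (fun y => 'D_(delta_mx d 0) f y)}) ->
  differentiable f x.
Proof.
move=> df cf.
pose a d := 'D_(delta_mx d 0) f x.
pose l (h : 'cV[R]_m) : R := \sum_d h d 0 * a d.
have l_lin : linear l.
  move=> k y z; rewrite /l scaler_sumr -big_split /=; apply: eq_bigr => d _.
  by rewrite !mxE mulrDl -mulrA.
pose lM := GRing.isLinear.Build _ _ _ _ _ l_lin.
pose L : {linear 'cV[R]_m -> R} := HB.pack l lM.
have cl : continuous l.
  move=> y; apply: (@cvg_big _ _ _ _ _ add_continuous _ (nbhs y) _ _ _ (nbhs_filter y)) => d _.
  apply: cvgM; last exact: cvg_cst.
  exact: coord_continuous.
suff : is_diff x f L by move=> [].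
apply: is_diff_linear_approx => // e e0.
(* m + 1 rather than m, which may be 0 *)
pose e' := e / m.+1%:R.
have e'0 : 0 < e' by rewrite divr_gt0.
have : \forall y \near x, (forall d, derivable f y (delta_mx d 0)) /\
    (forall d, `|a d - 'D_(delta_mx d 0) f y| < e').
  apply: filterI => //.
  apply: (@filter_forall _ _ (fun d y => `|a d - 'D_(delta_mx d 0) f y| < e')
    (nbhs x) (nbhs_filter x)) => d.
  by have /cvgrPdist_lt /(_ _ e'0) := cf d.
move=> /nbhs_ballP[r /= r0 xr].
apply/nbhs_ballP; exists r => //= h; rewrite /= -ball_normE /= sub0r normrN => hr.
(* h with all but its first j coordinates erased *)
pose p j : 'cV[R]_m := \col_i (if (i < j)%N then h i 0 else 0).
have pS (d : 'I_m) : p d.+1 = h d 0 *: delta_mx d 0 + p d.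
  apply/colP => i; rewrite !mxE eqxx andbT ltnS leq_eqVlt (inj_eq val_inj).
  by case: eqVneq => [->|]/=; rewrite ?ltnn ?addr0 ?mulr1 ?mulr0 ?add0r.
have p0 : p 0%N = 0 by apply/colP => i; rewrite !mxE.
have pm : p m = h by apply/colP => i; rewrite !mxE ltn_ord.
have -> : f (h + x) - f x - L h =
    \sum_(d < m) (f (p d.+1 + x) - f (p d + x) - h d 0 * a d).
  rewrite sumrB /L /= /l; congr (_ - _).
  rewrite -(big_mkord xpredT (fun d => f (p d.+1 + x) - f (p d + x))).
  by rewrite (telescope_sumr (fun d => f (p d + x))) // pm p0 add0r.
have term (d : 'I_m) : `|f (p d.+1 + x) - f (p d + x) - h d 0 * a d| <= e' * `|h|.
  have inb (t : R) : 0 <= t <= 1 ->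
      ball x r (t *: (h d 0 *: delta_mx d 0) + (p d + x)).
    move=> /andP[t0 t1]; rewrite -ball_normE /= addrA opprD addrCA subrr addr0 normrN.
    apply: le_lt_trans hr; apply: norm_le_coord => // i j.
    rewrite !mxE; case: (eqVneq i d) => [->|ne] /=.
      rewrite ltnn addr0 (ord1 j) eqxx mulr1 normrM ger0_norm //.
      apply: le_trans (coord_le_norm h d 0).
      by rewrite ler_piMl.
    rewrite !mulr0 add0r; case: ifP => _; last by rewrite normr0.
    exact: coord_le_norm.
  have [|t t01] := @mvt_line R _ f (p d + x) (h d 0 *: delta_mx d 0).
    move=> t /inb /xr [/(_ d) Hd _].
    by case: (is_derive_scaled_direction (h d 0) Hd).
  rewrite addrA -pS => ->.
  have [/(_ d) Hd /(_ d) He] := xr _ (inb t t01).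
  have [_ ->] := is_derive_scaled_direction (h d 0) Hd.
  rewrite -[_ *: _]/(_ * _) -mulrBr normrM mulrC ler_pM //; last exact: coord_le_norm.
  by rewrite distrC ltW.
apply: le_trans (ler_norm_sum _ _ _) _.
apply: le_trans (ler_sum _ (fun d _ => term d)) _.
rewrite sumr_const card_ord -mulr_natl mulrA ler_wpM2r // /e' mulrCA ger_pMr //.
by rewrite ler_pdivrMr // mul1r ler_nat.
Qed.

End Coordinates.

Section Clairaut.
Context {R : realType} {V : normedModType R}.
Implicit Types (f fv fw fvw fwv : V -> R) (x v w : V).

(** Two applications of the mean value theorem, first in the direction v to
    y |-> f (s w + y) - f y, then in the direction w to the derivative fv. *)
Lemma second_difference f fv fvw x v w (s : R) : 0 < s ->
  (forall a b : R, 0 <= a <= s -> 0 <= b <= s ->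
     is_derive (b *: w + (a *: v + x)) v f (fv (b *: w + (a *: v + x))) /\
     is_derive (b *: w + (a *: v + x)) w fv (fvw (b *: w + (a *: v + x)))) ->
  exists a b : R, [/\ 0 <= a <= s, 0 <= b <= s &
    f (s *: w + (s *: v + x)) - f (s *: v + x) - (f (s *: w + x) - f x) =
    s ^+ 2 * fvw (b *: w + (a *: v + x))].
Proof.
move=> s0 df.
have s_s : 0 <= s <= s by rewrite lexx ltW.
have s_0 : 0 <= (0 : R) <= s by rewrite lexx ltW.
pose phi (t : R) := f (t *: v + (s *: w + x)) - f (t *: v + x).
pose dphi (t : R) := fv (t *: v + (s *: w + x)) - fv (t *: v + x).
have phid (t : R) : 0 <= t <= s -> is_derive t (1 : R) phi (dphi t).
  move=> t0s; apply: is_deriveB.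
    have [H _] := df t s t0s s_s; rewrite (addrCA (s *: w)) in H.
    by have [d1 <-] := H; exact: is_derive_line.
  have [H _] := df t 0 t0s s_0; rewrite scale0r add0r in H.
  by have [d1 <-] := H; exact: is_derive_line.
have [] := @MVT R phi dphi 0 s s0.
- by move=> t; rewrite in_itv /= => /andP[/ltW t0 /ltW t1]; apply/phid/andP.
- apply: derivable_within_continuous => t; rewrite in_itv /= => t01.
  by case: (phid t t01).
move=> a; rewrite in_itv /= => /andP[/ltW a0 /ltW a1]; rewrite subr0 => Ea.
have a01 : 0 <= a <= s by apply/andP.
pose psi (t : R) := fv (t *: w + (a *: v + x)).
pose dpsi (t : R) := fvw (t *: w + (a *: v + x)).
have psid (t : R) : 0 <= t <= s -> is_derive t (1 : R) psi (dpsi t).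
  move=> t0s; have [_ H] := df a t a01 t0s; rewrite /dpsi.
  by have [d1 <-] := H; exact: is_derive_line.
have [] := @MVT R psi dpsi 0 s s0.
- by move=> t; rewrite in_itv /= => /andP[/ltW t0 /ltW t1]; apply/psid/andP.
- apply: derivable_within_continuous => t; rewrite in_itv /= => t01.
  by case: (psid t t01).
move=> b; rewrite in_itv /= => /andP[/ltW b0 /ltW b1]; rewrite subr0 => Eb.
exists a, b; split => //; first by apply/andP.
move: Ea; rewrite /phi /dphi scale0r !add0r (addrCA (s *: v)) (addrCA (a *: v)) => ->.
move: Eb; rewrite /psi /dpsi scale0r !add0r => ->.
by rewrite -mulrA -expr2 mulrC.
Qed.

(** The second difference of f is symmetric in v and w, so that
    second_difference, used both ways, makes fvw and fwv agree at points
    arbitrarily close to x; continuity at x then identifies their values there. *)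
Lemma clairaut f fv fw fvw fwv x v w :
  (\forall y \near x, [/\ is_derive y v f (fv y), is_derive y w f (fw y),
     is_derive y w fv (fvw y) & is_derive y v fw (fwv y)]) ->
  {for x, continuous fvw} -> {for x, continuous fwv} ->
  fvw x = fwv x.
Proof.
move=> df cvw cwv; apply/eqP; rewrite -subr_eq0 -normr_le0.
apply/ler_addgt0Pl => e e0; rewrite addr0.
have e20 : 0 < e / 2 by rewrite divr_gt0.
have : \forall y \near x, [/\ is_derive y v f (fv y), is_derive y w f (fw y),
     is_derive y w fv (fvw y) & is_derive y v fw (fwv y)] /\
    (`|fvw x - fvw y| < e / 2 /\ `|fwv x - fwv y| < e / 2).
  apply: filterI => //; apply: filterI.
    by move/cvgrPdist_lt: cvw => /(_ _ e20).
  by move/cvgrPdist_lt: cwv => /(_ _ e20).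
move=> /nbhs_ballP[r /= r0 xr].
pose c := `|v| + `|w| + 1.
have c0 : 0 < c by rewrite ltr_wpDl // addr_ge0.
(* small enough for the parallelogram spanned by s v and s w to lie in the ball *)
pose s := r / (2 * c).
have s0 : 0 < s by rewrite divr_gt0 // mulr_gt0.
have inb (a b : R) : 0 <= a <= s -> 0 <= b <= s -> ball x r (b *: w + (a *: v + x)).
  move=> /andP[a0 a1] /andP[b0 b1].
  rewrite -ball_normE /= addrA opprD addrCA subrr addr0 normrN.
  apply: le_lt_trans (ler_normD _ _) _; rewrite !normrZ !ger0_norm //.
  have : s * c < r by rewrite /s invfM mulrA divfK ?gt_eqF // ltr_pdivrMr // ltr_pMr ?ltr1n.
  apply: le_lt_trans; rewrite /c mulrDr mulrDr mulr1 addrC -addrA.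
  rewrite lerD ?ler_wpM2r // -[leLHS]addr0 lerD ?ler_wpM2r // ltW //.
have [|a [b [a01 b01 E1]]] := @second_difference f fv fvw x v w s s0.
  move=> a b a01 b01; have [[d1 _ d3 _] _] := xr _ (inb a b a01 b01).
  exact: (conj d1 d3).
have [|b' [a' [b'01 a'01 E2]]] := @second_difference f fw fwv x w v s s0.
  move=> b' a' b'01 a'01; have [[_ d2 _ d4] _] := xr _ (inb a' b' a'01 b'01).
  by rewrite addrCA; exact: (conj d2 d4).
have [_ [+ _]] := xr _ (inb a b a01 b01).
have [_ [_ +]] := xr _ (inb a' b' a'01 b'01).
rewrite (addrCA (b' *: w)).
have : fvw (b *: w + (a *: v + x)) = fwv (a' *: v + (b' *: w + x)).
  have s20 : s ^+ 2 != 0 by rewrite expf_neq0 // gt_eqF.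
  apply: (mulfI s20); rewrite -{}E1 -{}E2 (addrCA (s *: v)).
  by rewrite !opprB addrACA [RHS]addrACA; congr (_ + _); rewrite addrC.
move: (fvw (b *: _ + _)) (fwv (a' *: _ + _)) => p q -> l1 l2.
rewrite -(subrK q (fvw x)) -addrA.
apply: le_trans (ler_normD _ _) _; rewrite (splitr e) lerD // ?ltW //.
by rewrite distrC.
Qed.

End Clairaut.

Section VectorDerivatives.
Context {R : realType} {V : normedModType R}.

Lemma is_derive_cV n (f : V -> 'cV[R]_n) x v (df : 'cV[R]_n) :
  (forall i, is_derive x v (fun y => f y i 0 : R) (df i 0)) -> is_derive x v f df.
Proof.
move=> fi; have dfx : derivable f x v.
  by apply/derivable_mxP => i j; rewrite (ord1 j); case: (fi i).
split=> //; rewrite derive_mx //; apply/colP => i; rewrite mxE.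
by case: (fi i).
Qed.

Lemma is_derive_coord n (f : V -> 'cV[R]_n) x v (df : 'cV[R]_n) i :
  is_derive x v f df -> is_derive x v (fun y => f y i 0 : R) (df i 0).
Proof.
move=> [fx <-]; split; first by move/derivable_mxP: fx; apply.
by rewrite derive_mx // mxE.
Qed.

Lemma continuous_cV n (f : V -> 'cV[R]_n) x :
  (forall i, {for x, continuous (fun y => f y i 0)}) -> {for x, continuous f}.
Proof.
move=> fi; apply/cvgrPdist_le => e e0.
have : \forall y \near x, forall i, `|f x i 0 - f y i 0| <= e.
  apply: filter_forall => i.
  by have /cvgrPdist_le /(_ _ e0) := fi i.
apply: filterS => y fy; apply: norm_le_coord; first exact: ltW.
by move=> i j; rewrite (ord1 j) !mxE.
Qed.

(** Only directional derivability of the inner map is assumed, hence the detour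
    through the curve t |-> h (t v + x). *)
Lemma is_derive_comp_diff {W X : normedModType R} (f : W -> X) (h : V -> W) x v dh :
  differentiable f (h x) -> is_derive x v h dh ->
  is_derive x v (f \o h) ('d f (h x) dh).
Proof.
move=> df [dhx <-].
pose c (t : R) := h (t *: v + x).
have c0 : c 0 = h x by rewrite /c scale0r add0r.
have Dc : 'D_1 c 0 = 'D_v h x.
  have := @is_derive_line R _ _ h x v 0; rewrite scale0r add0r.
  by move=> /(_ dhx) /@derive_val.
have dc : differentiable c (0 : R).
  by apply/derivable1_diffP; exact: (derivable1P h x v).1.
have dfc : differentiable (f \o c) (0 : R).
  by apply: differentiable_comp => //; rewrite c0.
have d1 : derivable (f \o h) x v.
  by apply: (derivable1P _ _ _).2; apply/derivable1_diffP.
split=> //.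
have := @is_derive_line R _ _ (f \o h) x v 0; rewrite scale0r add0r.
move=> /(_ d1) /@derive_val <-.
rewrite -[LHS]/('D_1 (f \o c) 0) deriveE // diff_comp //; last by rewrite c0.
by rewrite /= c0 -Dc deriveE.
Qed.

End VectorDerivatives.

(** * Scalar functions of class C^k *)

Section Smooth.
Context {R : realType}.

(** Class C^k on U, by recursion on k.  Only partial derivability is asked for:
    differentiability follows when k > 0 (smooth_differentiable), so that closure
    properties have partial derivatives as their only obligation. *)
Fixpoint smooth m (k : nat) (U : set 'cV[R]_m) (f : 'cV[R]_m -> R) : Prop :=
  if k is k'.+1 then
    forall d, (forall x, U x -> derivable f x (delta_mx d 0)) /\
              smooth k' U (fun x => 'D_(delta_mx d 0) f x)
  else forall x, U x -> {for x, continuous f}.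

Section Algebra.
Variables (m : nat) (U : set 'cV[R]_m).
Hypothesis Uo : open U.
Implicit Types (f g : 'cV[R]_m -> R) (k : nat).

Lemma near_open (P : 'cV[R]_m -> Prop) x :
  (forall y, U y -> P y) -> U x -> \forall y \near x, P y.
Proof. by move=> UP Ux; have := open_nbhs_nbhs (conj Uo Ux); apply: filterS. Qed.

Lemma smooth_eq k f g : (forall x, U x -> f x = g x) -> smooth k U f -> smooth k U g.
Proof.
elim: k f g => [|k IH] f g fg /=.
  move=> cf x Ux; rewrite /prop_for /continuous_at -fg //.
  apply: cvg_trans (cf x Ux).
  exact: (@near_eq_cvg _ _ (nbhs x) (nbhs_filter x) f g (near_open fg Ux)).
have nfg x : U x -> \forall y \near x, f y = g y := near_open fg.
move=> sf d; have [df Df] := sf d; split.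
  by move=> x Ux; apply: near_eq_derivable (df x Ux); exact: nfg.
apply: IH Df => x Ux; apply: near_eq_derive; exact: nfg.
Qed.

Lemma smooth_differentiable k f x : smooth k.+1 U f -> U x -> differentiable f x.
Proof.
elim: k f x => [|k IH] f x sf Ux; apply: continuous_partials_differentiable.
- by apply: near_open Ux => y Uy d; exact: (sf d).1.
- by move=> d; exact: (sf d).2.
- by apply: near_open Ux => y Uy d; exact: (sf d).1.
- by move=> d; apply: differentiable_continuous; apply: IH => //; exact: (sf d).2.
Qed.

Lemma smoothW k f : smooth k.+1 U f -> smooth k U f.
Proof.
elim: k f => [|k IH] f sf.
  by move=> x Ux; apply: differentiable_continuous; exact: smooth_differentiable Ux.
by move=> d; split; [exact: (sf d).1 | apply: IH; exact: (sf d).2].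
Qed.

Lemma smooth_le k l f : (k <= l)%N -> smooth l U f -> smooth k U f.
Proof.
move=> /subnK <-; elim: (l - k)%N => [|j IH] //; rewrite addSn.
by move=> /smoothW.
Qed.

Lemma smooth_cst k (c : R) : smooth k U (fun=> c).
Proof.
elim: k c => [|k IH] c /=; first by move=> x _; exact: cst_continuous.
move=> d; split=> [x _|]; first exact: derivable_cst.
by apply: smooth_eq (IH 0) => x _; rewrite derive_cst.
Qed.

Lemma smooth_coord k (i : 'I_m) : smooth k U (fun x => x i 0).
Proof.
case: k => [|k] /=; first by move=> x _; exact: coord_continuous.
have D (x v : 'cV[R]_m) : is_derive x v (fun x : 'cV[R]_m => x i 0 : R) (v i 0).
  exact: (@is_derive_coord _ _ _ id).
move=> d; split=> [x _|]; first by case: (D x (delta_mx d 0)).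
apply: smooth_eq (smooth_cst k ((delta_mx d 0 : 'cV[R]_m) i 0)) => x _.
by case: (D x (delta_mx d 0)).
Qed.

Lemma smoothD k f g : smooth k U f -> smooth k U g -> smooth k U (fun x => f x + g x).
Proof.
elim: k f g => [|k IH] f g sf sg.
  by move=> x Ux; apply: continuousD; [exact: sf|exact: sg].
move=> d; have [df Df] := sf d; have [dg Dg] := sg d; split=> [x Ux|].
  by apply: derivableD; [exact: df|exact: dg].
apply: smooth_eq (IH _ _ Df Dg) => x Ux.
by rewrite -deriveD //; [exact: df|exact: dg].
Qed.

Lemma smoothM k f g : smooth k U f -> smooth k U g -> smooth k U (fun x => f x * g x).
Proof.
elim: k f g => [|k IH] f g sf sg.
  by move=> x Ux; apply: continuousM; [exact: sf|exact: sg].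
move=> d; have [df Df] := sf d; have [dg Dg] := sg d; split=> [x Ux|].
  by apply: derivableM; [exact: df|exact: dg].
have := smoothD (IH _ _ (smoothW sf) Dg) (IH _ _ (smoothW sg) Df).
apply: smooth_eq => x Ux.
by rewrite -[LHS]deriveM //; [exact: df|exact: dg].
Qed.

Lemma smooth_sum k I (r : seq I) (F : I -> 'cV[R]_m -> R) :
  (forall i, smooth k U (F i)) -> smooth k U (fun x => \sum_(i <- r) F i x).
Proof.
move=> sF; elim: r => [|i r IH].
  by apply: smooth_eq (smooth_cst k 0) => x _; rewrite big_nil.
by apply: smooth_eq (smoothD (sF i) IH) => x _; rewrite big_cons.
Qed.

Lemma smooth_prod k I (r : seq I) (F : I -> 'cV[R]_m -> R) :
  (forall i, smooth k U (F i)) -> smooth k U (fun x => \prod_(i <- r) F i x).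
Proof.
move=> sF; elim: r => [|i r IH].
  by apply: smooth_eq (smooth_cst k 1) => x _; rewrite big_nil.
by apply: smooth_eq (smoothM (sF i) IH) => x _; rewrite big_cons.
Qed.

Lemma smoothV k f : (forall x, U x -> f x != 0) ->
  smooth k U f -> smooth k U (fun x => (f x)^-1).
Proof.
move=> f0; elim: k f f0 => [|k IH] f f0 sf.
  by move=> x Ux; apply: continuousV; [exact: f0|exact: sf].
move=> d; have [df Df] := sf d; split=> [x Ux|].
  by apply: derivableV; [exact: f0|exact: df].
have sV := IH _ f0 (smoothW sf).
have := smoothM (smooth_cst k (-1)) (smoothM (smoothM sV sV) Df).
apply: smooth_eq => x Ux.
rewrite (@deriveV R) //; [|exact: f0|exact: df].
by rewrite mulN1r -scaleNr; congr (- _ * _); rewrite -invfM -expr2.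
Qed.

Lemma smooth_det k n (A : 'cV[R]_m -> 'M[R]_n) :
  (forall i j, smooth k U (fun x => A x i j)) -> smooth k U (fun x => \det (A x)).
Proof.
move=> sA; apply: smooth_sum => s; apply: smoothM; first exact: smooth_cst.
exact: smooth_prod.
Qed.

(** Cramer's rule: the entries of the inverse are cofactors over the
    determinant. *)
Lemma smooth_invmx k n (A : 'cV[R]_m -> 'M[R]_n) i j :
  (forall x, U x -> A x \in unitmx) ->
  (forall i j, smooth k U (fun x => A x i j)) ->
  smooth k U (fun x => invmx (A x) i j).
Proof.
move=> uA sA.
have := smoothM (smoothV _ (smooth_det sA)) (smoothM (smooth_cst k ((-1) ^+ (j + i)))
  (@smooth_det k n.-1 (fun x => row' j (col' i (A x))) _)).
move=> H; apply: smooth_eq (H _ _) => [x Ux|x Ux|a b].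
- by rewrite /invmx uA // !mxE.
- by have := uA x Ux; rewrite unitmxE unitfE.
- by apply: smooth_eq (sA (lift j a) (lift i b)) => x _; rewrite !mxE.
Qed.

End Algebra.

(** The chain rule expresses the partials of the composite by those of f
    composed with h and those of h, to which the induction applies. *)
Lemma smooth_comp m p k (U : set 'cV[R]_m) (W : set 'cV[R]_p)
    (f : 'cV[R]_p -> R) (h : 'cV[R]_m -> 'cV[R]_p) :
  open U -> open W -> (forall x, U x -> W (h x)) ->
  smooth k W f -> (forall i, smooth k U (fun x => h x i 0)) ->
  smooth k U (fun x => f (h x)).
Proof.
move=> Uo Wo UW; elim: k f => [|k IH] f sf sh.
  move=> x Ux; apply: (@continuous_comp _ _ _ h f).
    by apply: continuous_cV => i; exact: sh.
  by apply: sf; exact: UW.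
move=> d.
have Dh x : U x -> is_derive x (delta_mx d 0 : 'cV[R]_m) (fun x => f (h x))
    (\sum_i 'D_(delta_mx i 0) f (h x) * 'D_(delta_mx d 0) (fun y => h y i 0) x).
  move=> Ux.
  have dhx : is_derive x (delta_mx d 0 : 'cV[R]_m) h
      (\col_i 'D_(delta_mx d 0) (fun y => h y i 0 : R) x).
    by apply: is_derive_cV => i; rewrite mxE; apply: derivableP; exact: (sh i d).1.
  have dfx : differentiable f (h x) by apply: smooth_differentiable sf _ => //; exact: UW.
  have := is_derive_comp_diff dfx dhx.
  rewrite -deriveE // derive_partials //.
  by under eq_bigr do rewrite mxE [_ *: _]mulrC.
split=> [x Ux|]; first by case: (Dh x Ux).
have H : smooth k U (fun x => \sum_i 'D_(delta_mx i 0) f (h x) *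
                          'D_(delta_mx d 0) (fun y => h y i 0) x).
  apply: (smooth_sum Uo) => i; apply: (smoothM Uo); last exact: (sh i d).2.
  by apply: (IH (fun y => 'D_(delta_mx i 0) f y)); [exact: (sf i).2 | move=> j; exact: (smoothW Uo)].
by apply: (smooth_eq Uo _ H) => x Ux; case: (Dh x Ux).
Qed.

End Smooth.

(** * Vector-valued maps of class C^k *)

Section CkMaps.
Context {R : realType}.

Lemma is_derive_lincomb (V : normedModType R) n p (a : R) (c : 'I_p -> R)
    (f0 : V -> 'cV[R]_n) (f : 'I_p -> V -> 'cV[R]_n) x v df0 df :
  is_derive x v f0 df0 -> (forall i, is_derive x v (f i) (df i)) ->
  is_derive x v (fun y => a *: (f0 y + \sum_i c i *: f i y))
    (a *: (df0 + \sum_i c i *: df i)).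
Proof.
move=> d0 df_.
have dc i := is_deriveZ (c i) (df_ i).
have ds : is_derive x v (fun y => \sum_i c i *: f i y) (\sum_i c i *: df i).
  have := is_derive_sum dc.
  by congr (is_derive _ _ _ _); apply/funext => y; rewrite fct_sumE.
exact: (is_deriveZ a (is_deriveD d0 ds)).
Qed.

Lemma pder_rcons m n (s : seq 'I_m) d (f : 'cV[R]_m -> 'cV[R]_n) :
  pder (rcons s d) f = pder s (fun x => 'D_(delta_mx d 0) f x).
Proof. by rewrite /pder foldr_rcons. Qed.

Lemma pder_cat m n (s t : seq 'I_m) (f : 'cV[R]_m -> 'cV[R]_n) :
  pder (s ++ t) f = pder s (pder t f).
Proof. by rewrite /pder foldr_cat. Qed.

Lemma Ck_on_le m n k l (U : set 'cV[R]_m) (f : 'cV[R]_m -> 'cV[R]_n) :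
  (k <= l)%N -> Ck_on l U f -> Ck_on k U f.
Proof.
move=> kl Cf s sk x Ux; have [cf df] := Cf s (leq_trans sk kl) x Ux.
by split=> // lt; apply: df; exact: leq_trans lt kl.
Qed.

Lemma Ck_on_pder m n k (U : set 'cV[R]_m) (f : 'cV[R]_m -> 'cV[R]_n) s :
  Ck_on (size s + k) U f -> Ck_on k U (pder s f).
Proof.
move=> Cf t tk x Ux; have [|cf df] := Cf (t ++ s) _ x Ux.
  by rewrite size_cat addnC leq_add2l.
rewrite pder_cat in cf df; split=> // lt; apply: df.
by rewrite size_cat addnC ltn_add2l.
Qed.

Variables (m : nat) (U : set 'cV[R]_m).
Hypothesis Uo : open U.

(** In pder the last index of the list is differentiated first, which gives a
    recursion on the class. *)
Lemma Ck_onS n k (f : 'cV[R]_m -> 'cV[R]_n) :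
  Ck_on k.+1 U f <-> (forall x, U x -> {for x, continuous f}) /\
  forall d, (forall x, U x -> derivable f x (delta_mx d 0)) /\
            Ck_on k U (fun x => 'D_(delta_mx d 0) f x).
Proof.
split=> [Cf|[cf df] s].
  split=> [x Ux|d]; first by have [] := Cf [::] isT x Ux.
  split=> [x Ux|s sk x Ux]; first by have [_ /(_ isT)] := Cf [::] isT x Ux.
  by have := Cf (rcons s d); rewrite size_rcons !ltnS pder_rcons => /(_ sk x Ux).
case: (lastP s) => [|{}s d] sk x Ux.
  by split=> [|_ d]; [exact: cf | exact: (df d).1].
rewrite size_rcons ltnS in sk.
by have := (df d).2 s sk x Ux; rewrite size_rcons ltnS pder_rcons.
Qed.

(** Transfers regularity questions about maps to the closure properties of
    smooth. *)
Lemma Ck_on_smooth n k (f : 'cV[R]_m -> 'cV[R]_n) :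
  Ck_on k U f <-> forall i, smooth k U (fun x => f x i 0).
Proof.
elim: k f => [|k IH] f.
  split=> [Cf i x Ux|sf [|//] _ x Ux].
    apply: (@continuous_comp _ _ _ f (fun y : 'cV[R]_n => y i 0)).
      by have [] := Cf [::] isT x Ux.
    exact: coord_continuous.
  by split=> //; apply: continuous_cV => i; exact: sf.
rewrite Ck_onS; split=> [[cf df] i d|sf].
  have [dfd /IH /(_ i) Cfd] := df d; split=> [x Ux|].
    by have /derivable_mxP := dfd x Ux; exact.
  apply: (smooth_eq Uo _ Cfd) => x Ux.
  by rewrite derive_mx ?mxE //; exact: dfd.
have dfd d x : U x -> derivable f x (delta_mx d 0).
  by move=> Ux; apply/derivable_mxP => i j; rewrite (ord1 j); exact: (sf i d).1.
split=> [x Ux|d].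
  by apply: continuous_cV => i; exact: (smooth_le Uo (leq0n _) (sf i)).
split=> [x|]; first exact: dfd.
apply/IH => i; apply: (smooth_eq Uo _ (sf i d).2) => x Ux.
by rewrite derive_mx ?mxE //; exact: dfd.
Qed.

Lemma pder_eq n (f g : 'cV[R]_m -> 'cV[R]_n) s :
  (forall x, U x -> f x = g x) -> forall x, U x -> pder s f x = pder s g x.
Proof.
move=> fg; elim: s => [|d s IH] x Ux; first exact: fg.
by apply: near_eq_derive; exact: (near_open Uo IH Ux).
Qed.

Lemma is_derive_comp_C1 (V : normedModType R) n (F : 'cV[R]_m -> 'cV[R]_n)
    (h : V -> 'cV[R]_m) u v dh :
  Ck_on 1 U F -> U (h u) -> is_derive u v h dh ->
  is_derive u v (F \o h) (\sum_d dh d 0 *: 'D_(delta_mx d 0) F (h u)).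
Proof.
move=> C1 Uh hd; apply: is_derive_cV => i; rewrite summxE.
have /Ck_on_smooth sF := C1.
have dF := smooth_differentiable Uo (sF i) Uh.
have := is_derive_comp_diff dF hd; rewrite -deriveE // derive_partials //.
move=> [d1 d2]; split=> //; rewrite [LHS]d2; apply: eq_bigr => d _.
have dFx : derivable F (h u) (delta_mx d 0).
  by apply/derivable_mxP => a b; rewrite (ord1 b); exact: (sF a d).1.
by rewrite mxE derive_mx // mxE.
Qed.

Lemma is_derive_C1 n (F : 'cV[R]_m -> 'cV[R]_n) x v :
  Ck_on 1 U F -> U x ->
  is_derive x v F (\sum_d v d 0 *: 'D_(delta_mx d 0) F x).
Proof. by move=> C1 Ux; exact: (@is_derive_comp_C1 _ _ F id x v v C1 Ux). Qed.

Lemma derive_swap n (F : 'cV[R]_m -> 'cV[R]_n) a b x : Ck_on 2 U F -> U x ->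
  'D_(delta_mx a 0) (fun y => 'D_(delta_mx b 0) F y) x =
  'D_(delta_mx b 0) (fun y => 'D_(delta_mx a 0) F y) x.
Proof.
move=> C2 Ux.
have C1 d : Ck_on 1 U (fun y => 'D_(delta_mx d 0) F y) by have /Ck_onS[_ /(_ d)[]] := C2.
have D1 d y : U y -> is_derive y (delta_mx d 0 : 'cV[R]_m) F ('D_(delta_mx d 0) F y).
  by move=> Uy; apply: derivableP; have /Ck_onS[_ /(_ d)[H _]] := C2; exact: H.
have D2 d e y : U y -> is_derive y (delta_mx e 0 : 'cV[R]_m)
   (fun y => 'D_(delta_mx d 0) F y)
   ('D_(delta_mx e 0) (fun y => 'D_(delta_mx d 0) F y) y).
  by move=> Uy; apply: derivableP; have /Ck_onS[_ /(_ e)[H _]] := C1 d; exact: H.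
have cD2 d e i : {for x, continuous (fun y =>
   'D_(delta_mx e 0) (fun y => 'D_(delta_mx d 0) F y) y i 0)}.
  apply: (@continuous_comp _ _ _ _ (fun y : 'cV[R]_n => y i 0)).
    have /Ck_onS[_ /(_ e)[_ C0]] := C1 d.
    by have [] := C0 [::] isT x Ux.
  exact: coord_continuous.
apply/colP => i.
apply: (@clairaut R _ (fun y => F y i 0)
  (fun y => 'D_(delta_mx b 0) F y i 0) (fun y => 'D_(delta_mx a 0) F y i 0)
  (fun y => 'D_(delta_mx a 0) (fun y => 'D_(delta_mx b 0) F y) y i 0)
  (fun y => 'D_(delta_mx b 0) (fun y => 'D_(delta_mx a 0) F y) y i 0)
  x (delta_mx b 0) (delta_mx a 0)) => //.
apply: (near_open Uo _ Ux) => y Uy.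
by split; apply: is_derive_coord; [exact: D1|exact: D1|exact: D2|exact: D2].
Qed.

Lemma pder_cons_eq n (f : 'cV[R]_m -> 'cV[R]_n) d s t :
  (forall x, U x -> pder s f x = pder t f x) ->
  forall x, U x -> pder (d :: s) f x = pder (d :: t) f x.
Proof. by move=> st x Ux; exact: (@pder_eq _ _ _ [:: d] st x Ux). Qed.

(** The head of s is moved to its place in t by adjacent swaps, each an instance
    of derive_swap; the tails are then permutations of each other. *)
Lemma pder_perm n k (f : 'cV[R]_m -> 'cV[R]_n) s t x : Ck_on k U f ->
  (size s <= k)%N -> perm_eq s t -> U x -> pder s f x = pder t f x.
Proof.
move=> Cf; elim: s t x => [|d s IH] t x sk st Ux.
  by have := perm_size st; case: t st.
have dt : d \in t by rewrite -(perm_mem st) mem_head.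
have sk' : (size s <= k)%N by apply: ltnW.
case/splitPr: dt st => t1 t2 st.
have {}st : perm_eq s (t1 ++ t2).
  by move: st; rewrite perm_sym -[d :: t2]cat1s perm_catCA perm_sym /= perm_cons.
rewrite (@pder_cons_eq _ _ d s (t1 ++ t2) _ x Ux); last by move=> y; apply: IH.
have : (size (t1 ++ t2) < k)%N by rewrite -(perm_size st).
elim: t1 x Ux {st IH} => [|c t1 IH] x Ux szt; first by [].
have E1 y : U y -> pder (d :: t1 ++ t2) f y = pder (t1 ++ d :: t2) f y.
  by move=> Uy; exact: IH Uy (ltnW szt).
rewrite cat_cons [RHS](esym (@pder_cons_eq _ _ c _ _ E1 x Ux)).
apply: derive_swap Ux; apply: Ck_on_pder.
by apply: Ck_on_le Cf; rewrite addn2.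
Qed.

Lemma pder_lincomb n p k (a : R) (c : 'I_p -> R) (f0 : 'cV[R]_m -> 'cV[R]_n)
    (f : 'I_p -> 'cV[R]_m -> 'cV[R]_n) s x :
  Ck_on k U f0 -> (forall i, Ck_on k U (f i)) -> (size s <= k)%N -> U x ->
  pder s (fun y => a *: (f0 y + \sum_i c i *: f i y)) x =
  a *: (pder s f0 x + \sum_i c i *: pder s (f i) x).
Proof.
move=> C0 Cf; elim: s x => [|d s IH] //= x sk Ux.
have -> : 'D_(delta_mx d 0) (pder s (fun y => a *: (f0 y + \sum_i c i *: f i y))) x =
   'D_(delta_mx d 0) (fun x => a *: (pder s f0 x + \sum_i c i *: pder s (f i) x)) x.
  apply: near_eq_derive; apply: (near_open Uo _ Ux) => y Uy.
  by rewrite IH // ltnW.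
have D g : Ck_on k U g -> is_derive x (delta_mx d 0 : 'cV[R]_m) (pder s g)
   ('D_(delta_mx d 0) (pder s g) x).
  by move=> Cg; apply: derivableP; have [_ /(_ sk)] := Cg s (ltnW sk) x Ux; apply.
have [_ Dl] := is_derive_lincomb a c (D _ _ C0) (fun i => D _ _ (Cf i)).
exact: Dl.
Qed.

End CkMaps.

(** * Quadratic forms and coercivity *)

Section Euclidean.
Context {R : realType}.

Definition dotp n (x y : 'cV[R]_n) : R := (x^T *m y) 0 0.

Lemma dotpE n (x y : 'cV[R]_n) : dotp x y = \sum_i x i 0 * y i 0.
Proof. by rewrite /dotp mxE; apply: eq_bigr => i _; rewrite mxE. Qed.

Lemma dotp_ge0 n (x : 'cV[R]_n) : 0 <= dotp x x.
Proof. by rewrite dotpE sumr_ge0 // => i _; rewrite -expr2 sqr_ge0. Qed.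

Lemma enorm_ge0 n (x : 'cV[R]_n) : 0 <= enorm x.
Proof. exact: sqrtr_ge0. Qed.

Lemma sqr_enorm n (x : 'cV[R]_n) : enorm x ^+ 2 = dotp x x.
Proof.
rewrite sqr_sqrtr ?dotpE; last by rewrite sumr_ge0 // => i _; rewrite sqr_ge0.
by apply: eq_bigr => i _; rewrite expr2.
Qed.

Lemma dotp_gt0 n (x : 'cV[R]_n) : x != 0 -> 0 < dotp x x.
Proof.
move=> x0; rewrite lt_neqAle dotp_ge0 andbT eq_sym.
apply: contra x0 => /eqP; rewrite dotpE => /eqP.
rewrite psumr_eq0; last by move=> i _; rewrite -expr2 sqr_ge0.
move=> /allP x0; apply/eqP/colP => i; rewrite mxE.
by have := x0 i (mem_index_enum _); rewrite -expr2 sqrf_eq0 => /eqP.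
Qed.

Lemma enorm0P n (x : 'cV[R]_n) : reflect (x = 0) (enorm x == 0).
Proof.
apply: (iffP eqP) => [|->]; last by apply/eqP; rewrite -sqrf_eq0 sqr_enorm /dotp mulmx0 mxE.
move=> x0; apply/eqP/negP => /negP /dotp_gt0.
by rewrite -sqr_enorm x0 expr0n ltxx.
Qed.

Lemma coord_le_enorm n (x : 'cV[R]_n) i : `|x i 0| <= enorm x.
Proof.
rewrite -(@ler_pXn2r _ 2) ?nnegrE ?enorm_ge0 // sqr_enorm dotpE real_normK ?num_real //.
by rewrite (bigD1 i) //= -expr2 lerDl sumr_ge0 // => j _; rewrite -expr2 sqr_ge0.
Qed.

Lemma norm_le_enorm n (x : 'cV[R]_n) : `|x| <= enorm x.
Proof.
by apply: norm_le_coord => [|i j]; [exact: enorm_ge0 | rewrite (ord1 j) coord_le_enorm].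
Qed.

Lemma enorm_le_norm n (x : 'cV[R]_n) : enorm x <= n%:R * `|x|.
Proof.
rewrite -(@ler_pXn2r _ 2) ?nnegrE ?enorm_ge0 ?mulr_ge0 // sqr_enorm dotpE.
apply: (@le_trans _ _ (\sum_(i < n) `|x| ^+ 2)).
  apply: ler_sum => i _; rewrite -expr2 -[leLHS]real_normK ?num_real //.
  by rewrite ler_pXn2r ?nnegrE // coord_le_norm.
rewrite sumr_const card_ord -[leLHS]mulr_natl exprMn ler_wpM2r ?sqr_ge0 //.
by rewrite -natrX ler_nat; case: (n) => // k; rewrite expnS expn1 leq_pmulr.
Qed.

(** The form takes a nonnegative value at b(y,y) x - b(x,y) y, and this value is
    b(y,y) times the difference of the two sides. *)
Lemma quadratic_cauchy_schwarz n (A : 'M[R]_n) (x y : 'cV[R]_n) : symposdef A ->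
  (x^T *m A *m y) 0 0 ^+ 2 <= (x^T *m A *m x) 0 0 * (y^T *m A *m y) 0 0.
Proof.
move=> [As Apd].
pose b (u v : 'cV[R]_n) := (u^T *m A *m v) 0 0.
have bC u v : b u v = b v u.
  by rewrite /b -[in RHS](trmxK u) -[in RHS]As -[in RHS](trmxK v) -!trmx_mul mulmxA !trmxK [RHS]mxE.
have bl (a c : R) u v z : b (a *: u + c *: v) z = a * b u z + c * b v z.
  by rewrite /b linearD /= !linearZ /= !mulmxDl -!scalemxAl !mxE.
have br (a c : R) u v z : b z (a *: u + c *: v) = a * b z u + c * b z v.
  by rewrite bC bl !(bC z).
have [->|y0] := eqVneq y 0.
  by rewrite !mulmx0 !mxE expr0n mulr0.
have y_gt0 : 0 < b y y := Apd y y0.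
rewrite -/(b x y) -/(b x x) -/(b y y).
pose z := b y y *: x + (- b x y) *: y.
have z0 : 0 <= b z z.
  have [->|/Apd /ltW //] := eqVneq z 0; by rewrite /b mulmx0 mxE.
have E : b z z = b y y * (b x x * b y y - b x y ^+ 2).
  by rewrite /z bl !br (bC y x); ring.
by move: z0; rewrite E pmulr_rge0 // subr_ge0.
Qed.

Lemma symposdef1 n : symposdef (1%:M : 'M[R]_n).
Proof. by split=> [|x x0]; [rewrite trmx1 | rewrite mulmx1; exact: dotp_gt0]. Qed.

Lemma cauchy_schwarz n (x y : 'cV[R]_n) : `|dotp x y| <= enorm x * enorm y.
Proof.
rewrite -(@ler_pXn2r _ 2) ?nnegrE ?mulr_ge0 ?enorm_ge0 // exprMn !sqr_enorm.
rewrite real_normK ?num_real //.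
by have := quadratic_cauchy_schwarz x y (symposdef1 n); rewrite !mulmx1.
Qed.

(** The operator norm is a supremum, which is meaningful only because this norm
    bounds it; it also measures the perturbation of the Jacobian. *)
Definition frobenius m n (A : 'M[R]_(m, n)) : R :=
  Num.sqrt (\sum_i \sum_j A i j ^+ 2).

Lemma enorm_mulmx m n (A : 'M[R]_(m, n)) x : enorm (A *m x) <= frobenius A * enorm x.
Proof.
have f0 : 0 <= \sum_i \sum_j A i j ^+ 2.
  by apply: sumr_ge0 => i _; apply: sumr_ge0 => j _; exact: sqr_ge0.
rewrite -(@ler_pXn2r _ 2) ?nnegrE ?mulr_ge0 ?enorm_ge0 ?sqrtr_ge0 //.
rewrite exprMn [frobenius A ^+ 2]sqr_sqrtr // [leLHS]sqr_enorm dotpE mulr_suml; apply: ler_sum => i _.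
rewrite -expr2.
have -> : (A *m x) i 0 = dotp (row i A)^T x by rewrite /dotp trmxK -row_mul [RHS]mxE.
have -> : \sum_j A i j ^+ 2 = enorm (row i A)^T ^+ 2.
  by rewrite sqr_enorm dotpE; apply: eq_bigr => j _; rewrite !mxE.
rewrite -exprMn -[leLHS]real_normK ?num_real //.
by rewrite ler_pXn2r ?nnegrE ?mulr_ge0 ?enorm_ge0 // cauchy_schwarz.
Qed.

Lemma enormZ n (a : R) (x : 'cV[R]_n) : enorm (a *: x) = `|a| * enorm x.
Proof.
apply/eqP; rewrite -(@eqrXn2 _ 2) ?mulr_ge0 ?enorm_ge0 //.
rewrite exprMn !sqr_enorm real_normK ?num_real // !dotpE mulr_sumr.
by apply/eqP; apply: eq_bigr => i _; rewrite !mxE; ring.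
Qed.

Lemma le_opnorm n (B : 'M[R]_n) x : enorm (B *m x) <= opnorm B * enorm x.
Proof.
have ub : has_ubound [set enorm (B *m x) | x in [set x : 'cV[R]_n | enorm x <= 1]].
  exists (frobenius B) => _ [z /= z1 <-].
  by apply: le_trans (enorm_mulmx _ _) _; rewrite ler_piMr ?sqrtr_ge0.
have [->|x0] := eqVneq x 0.
  by rewrite mulmx0; have /enorm0P/eqP -> : (0 : 'cV[R]_n) = 0 by []; rewrite mulr0.
have e0 : 0 < enorm x by rewrite lt_neqAle enorm_ge0 andbT eq_sym; apply: contra x0 => /enorm0P ->.
rewrite -ler_pdivrMr // mulrC -[X in X * _]gtr0_norm ?invr_gt0 // -enormZ scalemxAr.
apply: ub_le_sup => //=; exists ((enorm x)^-1 *: x) => //=.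
by rewrite enormZ gtr0_norm ?invr_gt0 // mulVf // gt_eqF.
Qed.

(** The form would vanish at a vector of the left kernel. *)
Lemma posdef_unitmx n (A : 'M[R]_n) :
  (forall x : 'cV[R]_n, x != 0 -> 0 < (x^T *m A *m x) 0 0) -> A \in unitmx.
Proof.
move=> Apd; rewrite unitmxE unitfE; apply/negP => /det0P[v v0 vA].
have := Apd v^T; rewrite trmxK vA mul0mx mxE ltxx => F.
suff /F : v^T != 0 by [].
by apply: contra v0 => /eqP E; rewrite -(trmxK v) E trmx0.
Qed.

(** With y = A^-1 x, the Cauchy-Schwarz inequality for the form A gives
    |x|^4 <= (x^T A x) (y^T x) <= (x^T A x) C |x|^2. *)
Lemma inverse_bound_coercive n (A : 'M[R]_n) (C : R) (x : 'cV[R]_n) :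
  symposdef A -> opnorm (invmx A) <= C ->
  dotp x x <= C * (x^T *m A *m x) 0 0.
Proof.
move=> sA AC; have uA := posdef_unitmx sA.2.
have [->|x0] := eqVneq x 0; first by rewrite /dotp !mulmx0 mxE mulr0.
pose y := invmx A *m x.
have Ay : A *m y = x by rewrite mulKVmx.
have := quadratic_cauchy_schwarz x y sA.
rewrite -mulmxA Ay -/(dotp x x).
have -> : (y^T *m A *m y) 0 0 = dotp y x by rewrite -mulmxA Ay.
have yx : dotp y x <= C * dotp x x.
  apply: le_trans (ler_norm _) _; apply: le_trans (cauchy_schwarz _ _) _.
  rewrite -sqr_enorm expr2 mulrA ler_wpM2r ?enorm_ge0 //.
  by apply: le_trans (le_opnorm _ _) _; rewrite ler_wpM2r ?enorm_ge0.
have q0 := sA.2 x x0; have d0 := dotp_gt0 x0.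
move=> cs; rewrite -(ler_pM2r d0) -expr2; apply: le_trans cs _.
by rewrite [C * _]mulrC -mulrA ler_pM2l.
Qed.

(** By Cauchy-Schwarz, replacing A by B changes the form by at most d |x|^2. *)
Lemma quadratic_perturbation n (A B : 'M[R]_n) (C d rho : R) (x : 'cV[R]_n) :
  0 <= C -> dotp x x <= C * (x^T *m A *m x) 0 0 -> frobenius (B - A) <= d ->
  C * d <= rho -> (1 - rho) * dotp x x <= C * (x^T *m B *m x) 0 0.
Proof.
move=> C0 Ax BA Cd.
have E : (x^T *m B *m x) 0 0 = (x^T *m A *m x) 0 0 + dotp x ((B - A) *m x).
  by rewrite /dotp mulmxA mulmxBr mulmxBl [X in _ = _ + X]mxE [X in _ = _ + (_ + X)]mxE addrC subrK.
have pert : - (d * dotp x x) <= dotp x ((B - A) *m x).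
  suff : `|dotp x ((B - A) *m x)| <= d * dotp x x by rewrite ler_norml => /andP[].
  apply: le_trans (cauchy_schwarz _ _) _; rewrite -sqr_enorm expr2 mulrCA.
  rewrite ler_wpM2l ?enorm_ge0 //; apply: le_trans (enorm_mulmx _ _) _.
  by rewrite ler_wpM2r ?enorm_ge0.
rewrite E; have := ler_wpM2l C0 pert; have := ler_wpM2r (dotp_ge0 x) Cd; move: Ax.
by lra.
Qed.

End Euclidean.

(** * The solution map *)

Lemma continuous_for_dist {R : realType} {V W : normedModType R} (f : V -> W) x :
  {for x, continuous f} <->
  forall r : R, 0 < r -> \forall y \near x, `|f x - f y| < r.
Proof. by split=> [/cvgrPdist_lt|fx]; last apply/cvgrPdist_lt. Qed.

Section ImplicitSolution.
Context {R : realType} (N D K : nat).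
Variables (g0 : 'cV[R]_D -> 'cV[R]_D) (g : 'I_N -> 'cV[R]_D -> 'cV[R]_D).
Variables (W : set 'cV[R]_D).
Hypothesis Wo : open W.
Hypothesis K_gt0 : (0 < K)%N.
Hypotheses (Cg0 : Ck_on K W g0) (Cg : forall n, Ck_on K W (g n)).

Lemma is_derive_scale (V : normedModType R) n (a : V -> R) (F : V -> 'cV[R]_n) x v da dF :
  is_derive x v a da -> is_derive x v F dF ->
  is_derive x v (fun y => a y *: F y) (a x *: dF + da *: F x).
Proof.
move=> ha hF; apply: is_derive_cV => i; rewrite !mxE.
have := is_deriveM ha (is_derive_coord i hF).
rewrite [F x i 0 *: da]mulrC.
by congr (is_derive _ _ _ _); apply/funext => y; rewrite mxE.
Qed.

(** The partial derivative of G in theta with index list s, written through those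
    of the g_n.  It agrees with pder on W only (pder_G), but it is affine in
    u everywhere, which makes it convenient to differentiate in both arguments. *)
Definition G_partial (s : seq 'I_D) (theta : 'cV[R]_D) (u : 'cV[R]_N) : 'cV[R]_D :=
  N%:R^-1 *: (pder s g0 theta + \sum_(n < N) u n 0 *: pder s (g n) theta).

Lemma pder_G s u theta : (size s <= K)%N -> W theta ->
  pder s (fun t => G g0 g t u) theta = G_partial s theta u.
Proof.
move=> sK Wt.
exact: (pder_lincomb Wo N%:R^-1 (fun n => u n 0) Cg0 Cg sK Wt).
Qed.

(** Both arguments of G may move: this serves for the curve through a root
    in is_derive_that and for the differentiation of tau. *)
Lemma is_derive_G_partial (V : normedModType R) s (h : V -> 'cV[R]_D) (k : V -> 'cV[R]_N)
    x v dh dk :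
  (size s < K)%N -> W (h x) -> is_derive x v h dh -> is_derive x v k dk ->
  is_derive x v (fun y => G_partial s (h y) (k y))
    (\sum_d dh d 0 *: G_partial (d :: s) (h x) (k x) +
     N%:R^-1 *: \sum_(n < N) dk n 0 *: pder s (g n) (h x)).
Proof.
move=> sK Wx hh hk.
have C1 (f : 'cV[R]_D -> 'cV[R]_D) : Ck_on K W f -> Ck_on 1 W (pder s f).
  by move=> Cf; apply: Ck_on_pder; apply: Ck_on_le Cf; rewrite addn1.
have d0 := is_derive_comp_C1 Wo (C1 _ Cg0) Wx hh.
have dn n := is_derive_scale (is_derive_coord n hk)
               (is_derive_comp_C1 Wo (C1 _ (Cg n)) Wx hh).
have ds := is_derive_sum dn.
have {ds} := is_deriveZ N%:R^-1 (is_deriveD d0 ds).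
have -> : N%:R^-1 \*: (pder s g0 \o h +
    \sum_(n < N) (fun y => k y n 0 *: (pder s (g n) \o h) y)) =
    (fun y => G_partial s (h y) (k y)).
  by apply/funext => y; rewrite /G_partial /= fct_sumE.
congr (is_derive _ _ _ _).
rewrite big_split /= addrA scalerDr; congr (_ + _).
under [RHS]eq_bigr do rewrite /G_partial scalerA mulrC -scalerA.
rewrite -scaler_sumr; congr (_ *: _).
under [RHS]eq_bigr do rewrite scalerDr.
rewrite big_split /=; congr (_ + _).
under [RHS]eq_bigr do rewrite scaler_sumr.
rewrite exchange_big /=; apply: eq_bigr => n _.
rewrite scaler_sumr; apply: eq_bigr => d _.
by rewrite !scalerA mulrC.
Qed.

Lemma H_mulmx theta u v : W theta ->
  H g0 g theta u *m v = \sum_d v d 0 *: G_partial [:: d] theta u.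
Proof.
move=> Wt; apply/colP => i; rewrite mxE summxE; apply: eq_bigr => d _.
rewrite [RHS]mxE mulrC; congr (_ * _).
by rewrite /H /jacobian_mx mxE /darray ffunE pder_G.
Qed.

Variables (U : set 'cV[R]_N) (that : 'cV[R]_N -> 'cV[R]_D) (c e : R).
Hypothesis Uo : open U.
Hypothesis root : forall u, U u -> G g0 g (that u) u = 0.
Hypothesis c_gt0 : 0 < c.
Hypothesis coercive : forall theta u x, W theta -> U u ->
  c * dotp x x <= (x^T *m H g0 g theta u *m x) 0 0.
Hypothesis e_gt0 : 0 < e.
Hypothesis tube : forall u1 u2 (t : R) z, U u1 -> U u2 -> 0 <= t <= 1 ->
  `|z| < e -> W (t *: that u1 + (1 - t) *: that u2 + z).

Lemma W_that u : U u -> W (that u).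
Proof.
move=> Uu; have := @tube u u 1 0 Uu Uu.
by rewrite subrr scale0r !addr0 scale1r normr0 lexx ler01; apply.
Qed.

Lemma H_unitmx u : U u -> H g0 g (that u) u \in unitmx.
Proof.
move=> Uu; apply: posdef_unitmx => x x0.
apply: lt_le_trans (coercive x (W_that Uu) Uu).
by rewrite mulr_gt0 // dotp_gt0.
Qed.

(** Strong monotonicity: the derivative of z |-> (y - x) . G z u in the
    direction y - x is the quadratic form of the Jacobian at y - x, so by the mean
    value theorem (y - x) . (G y u - G x u) >= c |y - x|^2. *)
Lemma root_distance u x y : U u -> G g0 g y u = 0 ->
  (forall t : R, 0 <= t <= 1 -> W (t *: (y - x) + x)) ->
  c * enorm (y - x) <= enorm (G g0 g x u).
Proof.
move=> Uu Gy Wseg; set v := y - x.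
pose f (z : 'cV[R]_D) := dotp v (G_partial [::] z u).
have df (z : 'cV[R]_D) : W z -> is_derive z v f ((v^T *m H g0 g z u *m v) 0 0).
  move=> Wz; have := @is_derive_G_partial _ [::] id (fun=> u) z v v 0 K_gt0 Wz _ _.
  rewrite -H_mulmx // big1 ?scaler0 ?addr0; last by move=> n _; rewrite mxE scale0r.
  move=> /(_ (is_derive_id _ _) (is_derive_cst _ _ _)) dG.
  have -> : f = \sum_(i < D) (fun z => v i 0 * G_partial [::] z u i 0).
    by apply/funext => a; rewrite fct_sumE /f dotpE.
  rewrite -mulmxA -/(dotp v _) dotpE; apply: is_derive_sum => i.
  exact: (is_deriveZ (v i 0) (is_derive_coord i dG)).
have [t t01|t t01] := @mvt_line R _ f x v; first by case: (df _ (Wseg t t01)).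
have [_ ->] := df _ (Wseg t t01); rewrite subrK => E.
have : c * enorm v ^+ 2 <= enorm v * enorm (G g0 g x u).
  rewrite sqr_enorm; apply: le_trans (coercive v (Wseg t t01) Uu) _.
  rewrite -E /f -![G_partial [::] _ _]/(G g0 g _ u) Gy.
  rewrite [dotp v 0]/dotp mulmx0 [X in X - _]mxE sub0r.
  apply: le_trans (ler_norm _) _; rewrite normrN; exact: cauchy_schwarz.
have [->|/eqP v0] := eqVneq v 0.
  by have /enorm0P/eqP -> : (0 : 'cV[R]_D) = 0 by []; rewrite mulr0 enorm_ge0.
rewrite expr2 mulrA [leRHS]mulrC ler_pM2r // lt_neqAle enorm_ge0 andbT eq_sym.
by apply/negP => /enorm0P.
Qed.

Lemma G_continuous theta u : {for u, continuous (fun u => G g0 g theta u)}.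
Proof.
apply: continuous_cV => i.
have T := @openT 'cV[R]_N.
have S : smooth 0 setT (fun u : 'cV[R]_N => N%:R^-1 * (g0 theta i 0 +
    \sum_(n < N) u n 0 * g n theta i 0)).
  apply: (smoothM T); first exact: (smooth_cst T).
  apply: (smoothD T); first exact: (smooth_cst T).
  apply: (smooth_sum T) => n; apply: (smoothM T); first exact: (smooth_coord T).
  exact: (smooth_cst T).
apply: (smooth_eq T _ S u I) => z _; rewrite !mxE summxE.
by congr (_ * (_ + _)); apply: eq_bigr => n _; rewrite mxE.
Qed.

(** root_distance with x = that u, compared with the root at a nearby weight z:
    G (that u) z tends to G (that u) u = 0. *)
Lemma that_continuous u : U u -> {for u, continuous that}.
Proof.
move=> Uu; apply/continuous_for_dist => r r0.
have r'0 : 0 < c * r / D.+1%:R by rewrite divr_gt0 // mulr_gt0.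
have /continuous_for_dist /(_ _ r'0) := @G_continuous (that u) u.
rewrite root // => Gn; near=> z.
have Uz : U z by near: z; exact: (near_open Uo (fun z Uz => Uz) Uu).
have : c * enorm (that z - that u) <= enorm (G g0 g (that u) z).
  apply: (root_distance Uz (root Uz)) => t t01.
  have := @tube z u t 0 Uz Uu t01; rewrite normr0 addr0 => /(_ e_gt0).
  congr (W _); rewrite scalerBl scalerBr scale1r; by rewrite -addrA [- _ + _]addrC.
have : `|0 - G g0 g (that u) z| < c * r / D.+1%:R by near: z.
rewrite sub0r normrN => Gz Dz; rewrite distrC.
apply: le_lt_trans (norm_le_enorm _) _.
rewrite -(ltr_pM2l c_gt0); apply: le_lt_trans Dz _.
apply: le_lt_trans (enorm_le_norm _) _.
apply: (@le_lt_trans _ _ (D.+1%:R * `|G g0 g (that u) z|)).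
  by rewrite ler_wpM2r // ler_nat.
by rewrite mulrC -ltr_pdivlMr.
Unshelve. all: by end_near. Qed.

(** root_distance with x = that u + t p, where p is the claimed derivative: the
    residual psi t = G (that u + t p) (u + t v) has value and derivative 0 at
    t = 0, hence that (u + t v) - that u - t p = o(t).  The tube around segments
    between roots contains the segment from x to that (u + t v). *)
Lemma is_derive_that u v : U u -> is_derive u v that
  (- (invmx (H g0 g (that u) u) *m (N%:R^-1 *: \sum_(n < N) v n 0 *: g n (that u)))).
Proof.
move=> Uu; set p := - _.
pose psi (t : R) := G_partial [::] (t *: p + that u) (t *: v + u).
have line (V : normedModType R) (a b : V) (t : R) :
    is_derive t (1 : R) (fun s : R => s *: a + b) a.
  have := @is_derive_line R V V id b a t (@derivable_id _ _ _ _).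
  by rewrite derive_id.
have psi0 : psi 0 = 0 by rewrite /psi !scale0r !add0r -[LHS]/(G g0 g (that u) u) root.
have dpsi : is_derive (0 : R) (1 : R) psi 0.
  have W0 : W (0 *: p + that u) by rewrite scale0r add0r; exact: W_that.
  have := @is_derive_G_partial _ [::] _ _ (0 : R) 1 _ _ K_gt0 W0
     (line _ p (that u) 0) (line _ v u 0).
  rewrite scale0r add0r scale0r add0r -H_mulmx; last exact: W_that.
  by rewrite /p mulmxN mulKVmx ?H_unitmx // addNr.
have psi_small r : 0 < r -> \forall t \near (0 : R)^', `|t^-1 *: psi t| < r.
  move=> r0; have [d0 D0] := dpsi.
  have /cvgrPdist_lt /(_ _ r0) : (fun t : R => t^-1 *: ((psi \o shift 0) (t *: 1) - psi 0))
       t @[t --> 0^'] --> (0 : 'cV[R]_D).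
    by rewrite -[X in _ --> X]D0.
  apply: filterS => t; rewrite /= psi0 subr0 sub0r normrN addr0.
  by rewrite -[t *: 1]/(t * 1) mulr1.
have cv : (fun t : R => t^-1 *: ((that \o shift u) (t *: v) - that u)) t
            @[t --> 0^'] --> p.
  apply/cvgrPdist_lt => r r0.
  have r'0 : 0 < c * r / D.+1%:R by rewrite divr_gt0 // mulr_gt0.
  have [d /= d0 Ud] : exists2 d : R, 0 < d & ball u d `<=` U.
    by have /nbhs_ballP[d d0 Ud] := open_nbhs_nbhs (conj Uo Uu); exists d.
  have dv0 : 0 < d / (`|v| + 1) by rewrite divr_gt0 // ltr_wpDl.
  have ep0 : 0 < e / (`|p| + 1) by rewrite divr_gt0 // ltr_wpDl.
  near=> t.
  have tn0 : t != 0 by near: t; exact: nbhs_dnbhs_neq.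
  have bnd (V : normedModType R) (a : V) q : `|t| < q / (`|a| + 1) -> `|t *: a| < q.
    rewrite ltr_pdivlMr ?ltr_wpDl // normrZ; apply: le_lt_trans.
    by rewrite ler_wpM2l // lerDl.
  have Ut : U (t *: v + u).
    apply: Ud; rewrite -ball_normE /= opprD addrCA subrr addr0 normrN.
    by apply: bnd; near: t; exact: dnbhs0_lt.
  have tp : `|t *: p| < e by apply: bnd; near: t; exact: dnbhs0_lt.
  have psit : `|t^-1 *: psi t| < c * r / D.+1%:R by near: t; exact: psi_small.
  have := @root_distance (t *: v + u) (t *: p + that u) (that (t *: v + u)) Ut (root Ut).
  have seg (s : R) : 0 <= s <= 1 ->
      W (s *: (that (t *: v + u) - (t *: p + that u)) + (t *: p + that u)).
    move=> s01; have /andP[s0 s1] := s01.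
    have := @tube (t *: v + u) u s ((1 - s) *: (t *: p)) Ut Uu s01.
    have -> : s *: that (t *: v + u) + (1 - s) *: that u + (1 - s) *: (t *: p) =
       s *: (that (t *: v + u) - (t *: p + that u)) + (t *: p + that u).
      by rewrite -addrA -scalerDr [that u + _]addrC scalerBr scalerBl scale1r addrA addrAC addrA.
    apply; rewrite normrZ; apply: le_lt_trans tp.
    by rewrite ler_piMl // ger0_norm ?subr_ge0 // lerBlDr lerDl.
  move=> /(_ seg); rewrite -[G g0 g _ _]/(psi t) => Dt.
  have -> : p - t^-1 *: ((that \o shift u) (t *: v) - that u) =
     - (t^-1 *: (that (t *: v + u) - (t *: p + that u))).
    rewrite /= opprD [- _ - that u]addrC addrA [in RHS]scalerBr scalerK //.
    by rewrite opprB.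
  rewrite normrN; apply: le_lt_trans (norm_le_enorm _) _.
  rewrite -(ltr_pM2l c_gt0) enormZ mulrCA.
  apply: (@le_lt_trans _ _ (enorm (t^-1 *: psi t))).
    by rewrite enormZ ler_wpM2l.
  apply: le_lt_trans (enorm_le_norm _) _.
  apply: (@le_lt_trans _ _ (D.+1%:R * `|t^-1 *: psi t|)).
    by rewrite ler_wpM2r // ler_nat.
  by rewrite mulrC -ltr_pdivlMr.
split; first by apply/cvg_ex; exists p.
exact: cvg_lim cv.
Unshelve. all: by end_near. Qed.

(** Bootstrap: is_derive_that writes the partials of the solution map by means
    of H^-1 and g_n along that map.  The entries of H involve only first derivatives of
    the g_n, which is why the induction can go up to K. *)
Lemma Ck_on_that : Ck_on K U that.
Proof.
suff regular j : (j <= K)%N -> Ck_on j U that by exact: regular.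
elim: j => [|j IH] jK.
  by move=> s; case: s => [|//] _ x Ux; split=> //; exact: that_continuous.
have /(Ck_on_smooth Uo) sthat := IH (ltnW jK).
have sg (f : 'cV[R]_D -> 'cV[R]_D) i : Ck_on j W f -> smooth j U (fun u => f (that u) i 0).
  move=> Cf; have /(Ck_on_smooth Wo) sf := Cf.
  exact: (smooth_comp Uo Wo W_that (sf i) sthat).
have Cd (f : 'cV[R]_D -> 'cV[R]_D) d : Ck_on K W f -> Ck_on j W (fun y => 'D_(delta_mx d 0) f y).
  by move=> Cf; apply: (@Ck_on_pder _ _ _ _ _ f [:: d]); apply: Ck_on_le Cf.
apply/Ck_onS; split=> [u Uu|d]; first exact: that_continuous.
split=> [u Uu|]; first by case: (is_derive_that (delta_mx d 0) Uu).
apply/(Ck_on_smooth Uo) => i.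
pose B u := H g0 g (that u) u.
have sB a b : smooth j U (fun u => B u a b).
  have S : smooth j U (fun u => N%:R^-1 * ('D_(delta_mx b 0) g0 (that u) a 0 +
      \sum_(n < N) u n 0 * 'D_(delta_mx b 0) (g n) (that u) a 0)).
    apply: (smoothM Uo); first exact: (smooth_cst Uo).
    apply: (smoothD Uo); first exact: (sg (fun y => 'D_(delta_mx b 0) g0 y) a (Cd _ _ Cg0)).
    apply: (smooth_sum Uo) => n; apply: (smoothM Uo); first exact: (smooth_coord Uo).
    exact: (sg (fun y => 'D_(delta_mx b 0) (g n) y) a (Cd _ _ (Cg n))).
  apply: (smooth_eq Uo _ S) => u Uu.
  rewrite /B /H /jacobian_mx mxE /darray ffunE pder_G //; last exact: W_that.
  rewrite /G_partial !mxE summxE; congr (_ * (_ + _)).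
  by apply: eq_bigr => n _; rewrite mxE.
have sI := smooth_invmx Uo _ _ (fun u Uu => H_unitmx Uu) sB.
have S : smooth j U (fun u => - 1 * \sum_b invmx (B u) i b * (N%:R^-1 * g d (that u) b 0)).
  apply: (smoothM Uo); first exact: (smooth_cst Uo).
  apply: (smooth_sum Uo) => b; apply: (smoothM Uo); first exact: sI.
  apply: (smoothM Uo); first exact: (smooth_cst Uo).
  by apply: sg; apply: Ck_on_le (Cg d); exact: ltnW.
apply: (smooth_eq Uo _ S) => u Uu.
have [_ ->] := is_derive_that (delta_mx d 0) Uu.
rewrite mulN1r mxE; congr (- _); rewrite mxE; apply: eq_bigr => b _.
congr (_ * _); rewrite mxE; congr (_ * _); rewrite summxE (bigD1 d) //= big1.
  by rewrite !mxE !eqxx mul1r addr0.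
by move=> n nd; rewrite !mxE (negPf nd) mul0r.
Qed.

End ImplicitSolution.

(** * Derivative arrays applied to lists of vectors *)

Section ApplySeq.
Context {R : realType} {m n : nat}.
Implicit Types (A B : seq 'I_m -> 'cV[R]_n) (v : 'cV[R]_m) (vs : seq 'cV[R]_m).

(** The recursive counterpart of array_apply for an array indexed by lists;
    applying it to one vector at a time turns multilinearity and the Leibniz rule
    into inductions on the list of vectors. *)
Fixpoint apply_seq A vs : 'cV[R]_n :=
  if vs is v :: vs' then \sum_d v d 0 *: apply_seq (fun s => A (d :: s)) vs' else A [::].

Lemma sum_tupleS (Z : nmodType) k (F : k.+1.-tuple 'I_m -> Z) :
  \sum_(s : k.+1.-tuple 'I_m) F s =
  \sum_(d < m) \sum_(s : k.-tuple 'I_m) F (cons_tuple d s).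
Proof.
rewrite pair_big /= (reindex (fun p : 'I_m * k.-tuple 'I_m => cons_tuple p.1 p.2)) //=.
exists (fun s : k.+1.-tuple 'I_m => (thead s, behead_tuple s)) => [[d s] _|s _] /=.
  by rewrite theadE; congr (_, _); apply: val_inj.
by apply: val_inj; rewrite [in RHS](tuple_eta s).
Qed.

Lemma array_applyE A k (v : k.-tuple 'cV[R]_m) :
  array_apply [ffun s : k.-tuple 'I_m => A s] v = apply_seq A v.
Proof.
rewrite /array_apply; elim: k A v => [|k IH] A v.
  rewrite (tuple0 v) /= (big_pred1 [tuple]) ?big_ord0 ?scale1r ?ffunE //.
  by move=> s; rewrite (tuple0 s) /= eqxx.
rewrite sum_tupleS; case/tupleP: v => v0 v /=; apply: eq_bigr => d _.
rewrite -IH scaler_sumr; apply: eq_bigr => s _.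
rewrite !ffunE big_ord_recl !tnth0 scalerA; congr ((_ * _) *: _).
by apply: eq_bigr => i _; rewrite !tnthS.
Qed.

Lemma eq_apply_seq A B vs : (forall s, size s = size vs -> A s = B s) -> apply_seq A vs = apply_seq B vs.
Proof.
elim: vs A B => [|v vs IH] A B AB /=; first exact: AB.
by apply: eq_bigr => d _; congr (_ *: _); apply: IH => s sz; apply: AB; rewrite /= sz.
Qed.

Lemma apply_seqD A B vs : apply_seq (fun s => A s + B s) vs = apply_seq A vs + apply_seq B vs.
Proof.
elim: vs A B => [|v vs IH] A B //=; rewrite -big_split /=.
by apply: eq_bigr => d _; rewrite IH scalerDr.
Qed.

Lemma apply_seq_lincomb p (a : 'I_p -> R) (A : 'I_p -> seq 'I_m -> 'cV[R]_n) vs :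
  apply_seq (fun s => \sum_i a i *: A i s) vs = \sum_i a i *: apply_seq (A i) vs.
Proof.
elim: vs A => [|v vs IH] A //=.
under eq_bigr do rewrite IH scaler_sumr.
rewrite exchange_big /=; apply: eq_bigr => i _; rewrite scaler_sumr.
by apply: eq_bigr => d _; rewrite !scalerA mulrC.
Qed.

Lemma apply_seq_cons A v vs : apply_seq A (v :: vs) = apply_seq (fun s => \sum_d v d 0 *: A (d :: s)) vs.
Proof. by rewrite apply_seq_lincomb. Qed.

Lemma apply_seq_move A v vs vs' :
  (forall s t, perm_eq s t -> size s = (size vs + size vs').+1 -> A s = A t) ->
  apply_seq A (v :: vs ++ vs') = apply_seq A (vs ++ v :: vs').
Proof.
elim: vs A => [|c vs IH] A sA //=.
under eq_bigr do rewrite scaler_sumr.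
rewrite exchange_big /=; apply: eq_bigr => d _.
rewrite -IH /= => [|s t st sz]; last by apply: sA; rewrite ?perm_cons //= sz.
rewrite scaler_sumr; apply: eq_bigr => d' _.
rewrite !scalerA mulrC; congr (_ *: _); apply: eq_apply_seq => s sz; apply: sA.
  by rewrite (perm_catCA [:: d'] [:: d] s).
by rewrite /= sz size_cat.
Qed.

(** Symmetry is asked for index lists of the relevant length only, since partial
    derivatives commute only as far as the map is regular. *)
Lemma perm_apply_seq A vs vs' :
  (forall s t, perm_eq s t -> size s = size vs -> A s = A t) ->
  perm_eq vs vs' -> apply_seq A vs = apply_seq A vs'.
Proof.
elim: vs A vs' => [|v vs IH] A vs' sA pv.
  by have := perm_size pv; case: vs' pv.
have vv' : v \in vs' by rewrite -(perm_mem pv) mem_head.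
case/splitPr: vv' pv => t1 t2 pv.
have {}pv : perm_eq vs (t1 ++ t2).
  by move: pv; rewrite perm_sym -[v :: t2]cat1s perm_catCA perm_sym /= perm_cons.
rewrite -apply_seq_move => [|s t st sz]; last first.
  by apply: sA => //; rewrite sz /= (perm_size pv) size_cat.
by apply: eq_bigr => d _; congr (_ *: _); apply: IH => // s t st sz;
  apply: sA; rewrite ?perm_cons //= sz.
Qed.

(** All lists obtained from ks by raising a single entry by one: the terms of the
    Leibniz rule when the k-th derivative is differentiated into the next one. *)
Fixpoint incr_one (ks : seq nat) : seq (seq nat) :=
  if ks is k :: ks' then (k.+1 :: ks') :: [seq k :: ls | ls <- incr_one ks'] else [::].

Lemma is_derive_apply_seq_cst (V : normedModType R) (A : V -> seq 'I_m -> 'cV[R]_n) A' vs x y :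
  (forall s, size s = size vs -> is_derive x y (fun z => A z s) (A' s)) ->
  is_derive x y (fun z => apply_seq (A z) vs) (apply_seq A' vs).
Proof.
elim: vs A A' => [|v vs IH] A A' dA /=; first exact: dA.
have dd d : is_derive x y (fun z => v d 0 *: apply_seq (fun s => A z (d :: s)) vs)
    (v d 0 *: apply_seq (fun s => A' (d :: s)) vs).
  have := IH (fun z s => A z (d :: s)) (fun s => A' (d :: s)).
  move=> H; apply: (is_deriveZ (v d 0) (H _)).
  by move=> s sz; apply: dA; rewrite /= sz.
have := is_derive_sum dd.
by congr (is_derive _ _ _ _); apply/funext => z; rewrite fct_sumE.
Qed.

Lemma is_derive_apply_seq (V : normedModType R) (A : V -> seq 'I_m -> 'cV[R]_n) A'
    (th : nat -> V -> 'cV[R]_m) ks x y :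
  (forall s, size s = size ks -> is_derive x y (fun z => A z s) (A' s)) ->
  (forall k, k \in ks -> is_derive x y (th k) (th k.+1 x)) ->
  is_derive x y (fun z => apply_seq (A z) [seq th k z | k <- ks])
    (apply_seq A' [seq th k x | k <- ks] +
     \sum_(ls <- incr_one ks) apply_seq (A x) [seq th k x | k <- ls]).
Proof.
elim: ks A A' => [|k ks IH] A A' dA dth /=.
  by rewrite big_nil addr0; exact: dA.
have dd d : is_derive x y
    (fun z => th k z d 0 *: apply_seq (fun s => A z (d :: s)) [seq th k z | k <- ks])
    (th k x d 0 *: (apply_seq (fun s => A' (d :: s)) [seq th k x | k <- ks] +
       \sum_(ls <- incr_one ks) apply_seq (fun s => A x (d :: s)) [seq th k x | k <- ls])
     + th k.+1 x d 0 *: apply_seq (fun s => A x (d :: s)) [seq th k x | k <- ks]).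
  have dk : is_derive x y (th k) (th k.+1 x) by apply: dth; exact: mem_head.
  apply: (is_derive_scale (is_derive_coord d dk)).
  apply: (IH (fun z s => A z (d :: s)) (fun s => A' (d :: s))).
    by move=> s sz; apply: dA; rewrite /= sz.
  by move=> l lks; apply: dth; rewrite inE lks orbT.
have := is_derive_sum dd.
congr (is_derive _ _ _ _); first by apply/funext => z; rewrite fct_sumE.
rewrite big_split /= big_cons [in RHS]/= addrCA addrC; congr (_ + _).
under eq_bigr do rewrite scalerDr.
rewrite big_split /=; congr (_ + _).
rewrite big_map /=; under eq_bigr do rewrite scaler_sumr.
by rewrite exchange_big.
Qed.

End ApplySeq.

(** A list of terms may repeat, while a set cannot hold the same triple twice:
    coefficients of terms with the same key are added, after which the key
    determines the triple. *)
Lemma aggregate_terms {R : realType} (X Y : choiceType) (l : seq (R * X * Y)) :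
  exists F : {fset R * X * Y},
    (forall (V : lmodType R) (f : X -> Y -> V),
       \sum_(t <- F) t.1.1 *: f t.1.2 t.2 = \sum_(t <- l) t.1.1 *: f t.1.2 t.2) /\
    (forall t, t \in F -> (t.1.2, t.2) \in [seq (t.1.2, t.2) | t <- l]).
Proof.
pose key (t : R * X * Y) := (t.1.2, t.2).
pose ks := [fset x in [seq key t | t <- l]].
pose co (x : X * Y) := \sum_(t <- l | key t == x) t.1.1.
pose h (x : X * Y) : R * X * Y := (co x, x.1, x.2).
exists [fset h x | x in ks]; split=> [V f|t]; last first.
  by move=> /imfsetP[x /= + ->] /=; rewrite -surjective_pairing inE.
rewrite big_imfset /=; last by move=> [a b] [a' b'] _ _ /= [_ -> ->].
under eq_bigr do rewrite /co scaler_suml.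
rewrite (exchange_big_dep xpredT) //= big_seq [RHS]big_seq.
apply: eq_bigr => t tl; rewrite big_mkcond (bigD1_seq (key t)) ?fset_uniq //=; last first.
  by rewrite inE; apply: map_f.
by rewrite eqxx big1 ?addr0 // => x /negPf; rewrite eq_sym => ->.
Qed.

(** * Expansion of the directional derivatives *)

Section DirectionalExpansion.
Context {R : realType} (N D K : nat).
Variables (g0 : 'cV[R]_D -> 'cV[R]_D) (g : 'I_N -> 'cV[R]_D -> 'cV[R]_D).
Variables (W : set 'cV[R]_D) (U : set 'cV[R]_N) (that : 'cV[R]_N -> 'cV[R]_D).
Variable (w : 'cV[R]_N).
Hypotheses (Wo : open W) (Uo : open U) (K_gt0 : (0 < K)%N).
Hypotheses (Cg0 : Ck_on K W g0) (Cg : forall n, Ck_on K W (g n)).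
Hypothesis root : forall u, U u -> G g0 g (that u) u = 0.
Hypothesis W_that : forall u, U u -> W (that u).
Hypothesis Cthat : Ck_on K U that.

Let th k (u : 'cV[R]_N) : 'cV[R]_D := delta_that that w k u.

Lemma delta_thatE k u :
  th k u = apply_seq (fun s => pder s that u) (nseq k (Delta w)).
Proof. exact: (array_applyE (fun s => pder s that u)). Qed.

(** The expansion of a directional derivative in partial derivatives adds one
    more copy of Delta to the list of vectors. *)
Lemma is_derive_delta_that k u : (k < K)%N -> U u ->
  is_derive u (Delta w) (th k) (th k.+1 u).
Proof.
move=> kK Uu.
have dA s : size s = size (nseq k (Delta w)) -> is_derive u (Delta w) (pder s that)
    (\sum_d Delta w d 0 *: pder (d :: s) that u).
  rewrite size_nseq => sz; apply: (is_derive_C1 Uo) => //; apply: Ck_on_pder.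
  by apply: Ck_on_le Cthat; rewrite sz addn1.
have := is_derive_apply_seq_cst (A := fun z s => pder s that z) dA.
rewrite -(apply_seq_cons (fun s => pder s that u)) -[Delta w :: _]/(nseq k.+1 (Delta w)) -delta_thatE.
by congr (is_derive _ _ _ _); apply/funext => z; rewrite delta_thatE.
Qed.

(** The arrays that tau applies, indexed by lists of any length, so that one more
    differentiation in theta stays within the family. *)
Definition tau_array (omega : bool) (s : seq 'I_D) (u : 'cV[R]_N) : 'cV[R]_D :=
  if omega then N%:R^-1 *: \sum_(n < N) Delta w n 0 *: pder s (g n) (that u)
  else G_partial g0 g s (that u) u.

Definition tau_seq (omega : bool) (ks : seq nat) (u : 'cV[R]_N) : 'cV[R]_D :=
  apply_seq (fun s => tau_array omega s u) [seq th k u | k <- ks].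

Lemma tauE (M : {mset nat}) omega u : U u -> (size M <= K)%N ->
  tau g0 g that w M omega u = tau_seq omega M u.
Proof.
move=> Uu MK; rewrite /tau /=.
rewrite -[RHS](array_applyE (fun s => tau_array omega s u)
  (map_tuple (fun k => th k u) (in_tuple M))).
congr (array_apply _ _); case: omega; apply/ffunP => s; rewrite !ffunE /=.
  congr (_ *: _); rewrite sum_ffunE; apply: eq_bigr => n _.
  by rewrite !ffunE.
by apply: (pder_G Wo Cg0 Cg); rewrite ?size_tuple //; exact: W_that.
Qed.

Lemma perm_tau_seq omega ks ls u : U u -> (size ks <= K)%N -> perm_eq ks ls ->
  tau_seq omega ks u = tau_seq omega ls u.
Proof.
move=> Uu sK kl; apply: perm_apply_seq; last exact: perm_map.
have Wu := W_that Uu.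
move=> s t st; rewrite size_map => sz.
have sK1 : (size s <= K)%N by rewrite sz.
rewrite /tau_array /G_partial; case: omega; congr (_ *: _).
  by apply: eq_bigr => n _; rewrite (pder_perm Wo (Cg n) sK1 st Wu).
rewrite (pder_perm Wo Cg0 sK1 st Wu); congr (_ + _).
by apply: eq_bigr => n _; rewrite (pder_perm Wo (Cg n) sK1 st Wu).
Qed.

Lemma is_derive_that1 u : U u -> is_derive u (Delta w) that (th 1 u).
Proof.
move=> Uu; have := is_derive_delta_that K_gt0 Uu.
by congr (is_derive _ _ _ _); apply/funext => z; rewrite delta_thatE.
Qed.

(** The pairs (omega, K) produced by differentiating tau (K, omega) along Delta:
    through theta, through the weights in G (the second array does not depend on
    them), and through each of the vectors. *)
Definition dtau_indices (omega : bool) (ks : seq nat) : seq (bool * seq nat) :=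
  (omega, 1%N :: ks) :: (if omega then [::] else [:: (true, ks)])
  ++ [seq (omega, ls) | ls <- incr_one ks].

Lemma is_derive_tau_array omega s u : U u -> (size s < K)%N ->
  is_derive u (Delta w) (tau_array omega s)
    (\sum_d th 1 u d 0 *: tau_array omega (d :: s) u +
     (if omega then 0 else tau_array true s u)).
Proof.
move=> Uu sK; have Wu := W_that Uu; have d1 := is_derive_that1 Uu.
case: omega; last first.
  exact: (is_derive_G_partial Wo Cg0 Cg sK Wu d1 (is_derive_id _ _)).
have C1 n : Ck_on 1 W (pder s (g n)).
  by apply: Ck_on_pder; apply: Ck_on_le (Cg n); rewrite addn1.
have dn n := is_deriveZ (Delta w n 0) (is_derive_comp_C1 Wo (C1 n) Wu d1).
have := is_deriveZ N%:R^-1 (is_derive_sum dn).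
congr (is_derive _ _ _ _).
  by apply/funext => z; rewrite /tau_array /= fct_sumE.
rewrite addr0 /tau_array; under [RHS]eq_bigr do rewrite scalerA mulrC -scalerA scaler_sumr.
rewrite -scaler_sumr exchange_big /=; congr (_ *: _); apply: eq_bigr => n _.
by rewrite scaler_sumr; apply: eq_bigr => d _; rewrite !scalerA mulrC.
Qed.

Lemma is_derive_tau_seq omega ks u : U u -> (size ks < K)%N ->
  (forall k, k \in ks -> (k < K)%N) ->
  is_derive u (Delta w) (tau_seq omega ks)
    (\sum_(p <- dtau_indices omega ks) tau_seq p.1 p.2 u).
Proof.
move=> Uu sK kK.
have dA s : size s = size ks -> is_derive u (Delta w) (tau_array omega s)
    (\sum_d th 1 u d 0 *: tau_array omega (d :: s) u +
     (if omega then 0 else tau_array true s u)).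
  by move=> sz; apply: is_derive_tau_array; rewrite ?sz.
have := is_derive_apply_seq (A := fun z s => tau_array omega s z) dA
  (fun k kks => is_derive_delta_that (kK k kks) Uu).
congr (is_derive _ _ _ _).
rewrite /dtau_indices big_cons big_cat big_map /= addrA; congr (_ + _).
rewrite apply_seqD -(apply_seq_cons (fun s => tau_array omega s u)); congr (_ + _).
case: (omega); last by rewrite big_seq1.
rewrite big_nil; elim: (map _ _) => [|v vs IH] //=.
by rewrite big1 // => d _; rewrite IH scaler0.
Qed.

Definition term : Type := (R * seq nat * bool)%type.

Definition term_value (t : term) u := t.1.1 *: tau_seq t.2 t.1.2 u.

(** Besides the two properties of the statement, entries are recorded to be
    positive: the number of vectors is then at most k, which bounds the order of
    the derivatives of G in use. *)
Definition graded k (t : term) : bool :=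
  [&& all (fun k' => 0 < k' < k)%N t.1.2 & t.2 + sumn t.1.2 == k]%N.

Definition dterm (t : term) : seq term :=
  [seq (t.1.1, p.2, p.1) | p <- dtau_indices t.2 t.1.2].

Lemma size_le_sumn k ks : all (fun k' => 0 < k' < k)%N ks -> (size ks <= sumn ks)%N.
Proof.
elim: ks => [|l ks IH] //= /andP[/andP[l0 _] /IH h].
by rewrite -add1n leq_add.
Qed.

Lemma graded_size k t : graded k t -> (size t.1.2 <= k)%N.
Proof.
move=> /andP[/size_le_sumn h /eqP <-]; apply: leq_trans h _; exact: leq_addl.
Qed.

Lemma is_derive_term_value k t u : U u -> (k < K)%N -> graded k t ->
  is_derive u (Delta w) (term_value t) (\sum_(t' <- dterm t) term_value t' u).
Proof.
move=> Uu kK gt; have sz := graded_size gt.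
have /andP[/allP ak _] := gt.
have dt : is_derive u (Delta w) (tau_seq t.2 t.1.2)
    (\sum_(p <- dtau_indices t.2 t.1.2) tau_seq p.1 p.2 u).
  apply: is_derive_tau_seq => //; first exact: leq_ltn_trans sz kK.
  by move=> k' /ak /andP[_ h]; exact: ltn_trans h kK.
have := is_deriveZ t.1.1 dt.
by rewrite /dterm big_map scaler_sumr.
Qed.

Lemma incr_one_graded k ks ls : ls \in incr_one ks -> all (fun k' => 0 < k' < k)%N ks ->
  all (fun k' => 0 < k' < k.+1)%N ls /\ sumn ls = (sumn ks).+1.
Proof.
elim: ks ls => [|l ks IH] ls //=; rewrite inE => /orP[/eqP ->|/mapP[ls' ls'ks ->]].
  move=> /andP[/andP[l0 lk] aks] /=; rewrite !ltnS lk /=; split=> //.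
  by apply: sub_all aks => k' /andP[-> h]; rewrite ltnS ltnW.
move=> /andP[/andP[l0 lk] aks] /=; have [-> ->] := IH _ ls'ks aks.
by rewrite l0 ltnS (ltnW lk) addnS.
Qed.

(** Each way of differentiating raises the total degree by exactly one; the new
    entry 1 stays below k + 1 because k is positive. *)
Lemma dterm_graded k t : (0 < k)%N -> graded k t ->
  forall t', t' \in dterm t -> graded k.+1 t'.
Proof.
move=> k0 /andP[ak /eqP sk] t' /mapP[[om ls] + ->] /=.
have ak1 : all (fun k' => 0 < k' < k.+1)%N t.1.2.
  by apply: sub_all ak => k' /andP[-> h]; rewrite ltnS ltnW.
rewrite /dtau_indices inE mem_cat => /or3P[/eqP[-> ->]||/mapP[ls' /incr_one_graded h [-> ->]]].
- by rewrite /graded /= ltnS k0 ak1 /= -sk addnCA add1n.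
- case E : t.2 => //; rewrite inE => /eqP[-> ->].
  by rewrite /graded /= ak1 -sk E add0n add1n eqxx.
- have [h1 h2] := h k ak.
  by rewrite /graded /= h1 h2 -sk addnS eqxx.
Qed.

(** The case k = 1 differentiates G (that u) u = 0.  For the next case, the left
    side of the expansion is tau of the one-element list k; its derivative contains
    tau of the one-element list k + 1, and the two other terms are moved to the
    right with coefficient -1. *)
Lemma directional_expansion k : (0 < k <= K)%N ->
  exists T : seq term, (forall u, U u ->
     H g0 g (that u) u *m th k u = \sum_(t <- T) term_value t u) /\
     (forall t, t \in T -> graded k t).
Proof.
case: k => [//|k] /=; elim: k => [|k IH] kK.
  exists [:: (-1, [::], true)]; split=> [u Uu|t]; last by rewrite inE => /eqP ->.
  rewrite big_seq1 /term_value /tau_seq /= scaleN1r (H_mulmx Wo K_gt0 Cg0 Cg) //; last exact: W_that.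
  apply/eqP; rewrite -addr_eq0; apply/eqP.
  have [_ <-] := @is_derive_tau_array false [::] u Uu K_gt0.
  have -> : 'D_(Delta w) (tau_array false [::]) u = 'D_(Delta w) (cst 0) u.
    by apply: near_eq_derive; apply: (near_open Uo _ Uu) => z Uz; exact: root.
  exact: derive_cst.
have [T [TE Tg]] := IH (ltnW kK).
(* the last two terms are those created beside tau({k+2}, 0) on the left side *)
exists (flatten [seq dterm t | t <- T] ++
   [:: (-1, [:: 1; k.+1]%N, false); (-1, [:: k.+1], true)]).
split=> [u Uu|t]; last first.
  rewrite mem_cat => /orP[/flatten_mapP[t' /Tg t'g tt']|].
    exact: dterm_graded t'g _ tt'.
  by rewrite !inE => /orP[] /eqP ->; rewrite /graded /= ?ltnS ?leqnn ?addn0 ?add0n ?add1n /= eqxx.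
have HE z : U z -> H g0 g (that z) z *m th k.+1 z = tau_seq false [:: k.+1] z.
  by move=> Uz; rewrite (H_mulmx Wo K_gt0 Cg0 Cg) //; exact: W_that.
have E z : U z -> tau_seq false [:: k.+1] z = \sum_(t <- T) term_value t z.
  by move=> Uz; rewrite -HE // TE.
have [||_ dl] := @is_derive_tau_seq false [:: k.+1] u Uu.
- exact: leq_ltn_trans kK.
- by move=> k'; rewrite inE => /eqP ->.
have dr : is_derive u (Delta w) (fun z => \sum_(t <- T) term_value t z)
    (\sum_(t <- T) \sum_(t' <- dterm t) term_value t' u).
  have : all (graded k.+1) T by apply/allP.
  elim: (T) => [|t T' IHT] /=.
    move=> _; rewrite big_nil; have := is_derive_cst (0 : 'cV[R]_D) u (Delta w).
    by congr (is_derive _ _ _ _); apply/funext => z; rewrite big_nil.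
  move=> /andP[gt /IHT dT']; rewrite big_cons.
  have := is_deriveD (is_derive_term_value Uu kK gt) dT'.
  by congr (is_derive _ _ _ _); apply/funext => z; rewrite big_cons.
have : 'D_(Delta w) (tau_seq false [:: k.+1]) u =
    'D_(Delta w) (fun z => \sum_(t <- T) term_value t z) u.
  by apply: near_eq_derive; exact: (near_open Uo E Uu).
have [_ ->] := dr; rewrite dl.
rewrite /dtau_indices /= !big_cons big_nil addr0 => D1.
have -> : H g0 g (that u) u *m th k.+2 u = tau_seq false [:: k.+2] u.
  by rewrite (H_mulmx Wo K_gt0 Cg0 Cg) //; exact: W_that.
rewrite big_cat big_flatten big_map /= -D1 !big_cons big_nil addr0.
rewrite /term_value /= !scaleN1r -opprD.
by rewrite [_ + (_ + tau_seq _ [:: k.+2] _)]addrA addrAC subrr add0r.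
Qed.

End DirectionalExpansion.

(** * Geometry of the weight region *)

Section Geometry.
Context {R : realType}.

Lemma ler_enormD n (x y : 'cV[R]_n) : enorm (x + y) <= enorm x + enorm y.
Proof.
rewrite -(@ler_pXn2r _ 2) ?nnegrE ?addr_ge0 ?enorm_ge0 // sqrrD !sqr_enorm.
have -> : dotp (x + y) (x + y) = dotp x x + dotp x y *+ 2 + dotp y y.
  by rewrite !dotpE -sumrMnl -!big_split /=; apply: eq_bigr => i _; rewrite !mxE; ring.
rewrite lerD2r lerD2l lerMn2r /=.
by apply: le_trans (ler_norm _) _; exact: cauchy_schwarz.
Qed.

(** Differentiating an identity valid on Omega_w requires that it be open. *)
Lemma open_Omega_w n (eps : R) (w : 'cV[R]_n) : open (Omega_w eps w).
Proof.
rewrite openE => u [t [t01 ut]]; apply/nbhs_ballP.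
set z := (1 - t) *: ones n + t *: w in ut.
have r0 : 0 < (eps - enorm (u - z)) / n.+1%:R by rewrite divr_gt0 // subr_gt0.
exists ((eps - enorm (u - z)) / n.+1%:R) => //= v.
rewrite -ball_normE /= distrC ltr_pdivlMr // => uv.
exists t; split=> //; rewrite -/z -(subrK u v) -addrA.
apply: le_lt_trans (ler_enormD _ _) _; rewrite -ltrBrDr.
apply: le_lt_trans uv; apply: le_trans (enorm_le_norm _) _.
by rewrite mulrC ler_wpM2l // ler_nat.
Qed.

Lemma ones_Omega_w n (eps : R) (w : 'cV[R]_n) : 0 < eps -> Omega_w eps w (ones n).
Proof.
move=> eps0; exists 0; rewrite lexx ler01; split=> //.
rewrite subr0 scale1r scale0r addr0 subrr.
by have /enorm0P/eqP -> : (0 : 'cV[R]_n) = 0 by [].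
Qed.

Lemma convex_hull_segment n (A : set 'cV[R]_n) x y (t : R) : 0 <= t <= 1 ->
  A x -> A y -> convex_hull A (t *: x + (1 - t) *: y).
Proof.
move=> /andP[t0 t1] Ax Ay C [cC AC].
exact: set_mem (cC x y (Itv01 t0 t1) (mem_set (AC _ Ax)) (mem_set (AC _ Ay))).
Qed.

Lemma frobenius_H N D (g0 : 'cV[R]_D -> 'cV[R]_D) (g : 'I_N -> 'cV[R]_D -> 'cV[R]_D)
    theta u v :
  frobenius (H g0 g theta u - H g0 g theta v) =
  array_norm (dG g0 g 1 theta u - dG g0 g 1 theta v).
Proof.
rewrite /frobenius /array_norm sum_tupleS exchange_big /=; congr (Num.sqrt _).
apply: eq_bigr => j _; rewrite (big_pred1 [tuple]); last first.
  by move=> s; rewrite (tuple0 s) /= eqxx.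
apply: eq_bigr => i _.
have -> : cons_tuple j [tuple] = [tuple j] by apply: val_inj.
by rewrite /H /jacobian_mx /dG !ffunE !mxE !ffunE.
Qed.

End Geometry.

(** * From the quantitative hypotheses to the expansion *)

Theorem lemma3 (R : realType) (N D kIJ : nat)
    (g0 : 'cV[R]_D -> 'cV[R]_D) (g : 'I_N -> 'cV[R]_D -> 'cV[R]_D)
    (w : 'cV[R]_N) (eps : R) (that : 'cV[R]_N -> 'cV[R]_D)
    (Omega_theta : set 'cV[R]_D) (Cop rho : R) (M delta : nat -> R) :
  (1 <= N)%N -> (1 <= D)%N -> (1 <= kIJ)%N -> 0 < eps ->
  (forall u, Omega_w eps w u -> G g0 g (that u) u = 0) ->
  open Omega_theta ->
  (exists2 e : R, 0 < e & forall x y : 'cV[R]_D,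
     convex_hull (that @` Omega_w eps w) y -> enorm (x - y) < e ->
     Omega_theta x) ->
  Ck_on kIJ.+1 Omega_theta g0 ->
  (forall n : 'I_N, Ck_on kIJ.+1 Omega_theta (g n)) ->
  (forall theta, Omega_theta theta -> symposdef (H g0 g theta (ones N))) ->
  (forall theta, Omega_theta theta ->
     opnorm (invmx (H g0 g theta (ones N))) <= Cop) ->
  (forall k theta, (1 <= k <= kIJ.+1)%N -> Omega_theta theta ->
     array_norm (dG g0 g k theta (ones N)) <= M k) ->
  (forall k u theta, (k <= kIJ.+1)%N -> Omega_w eps w u -> Omega_theta theta ->
     array_norm (dG g0 g k theta u - dG g0 g k theta (ones N)) <= delta k) ->
  0 < rho < 1 ->
  Cop * delta 1%N + Cop ^+ 2 * M 2%N * delta 0%N <= rho ->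
  [/\ forall u, Omega_w eps w u -> H g0 g (that u) u \in unitmx,
      Ck_on kIJ.+1 (Omega_w eps w) that
    & forall k, (1 <= k <= kIJ.+1)%N ->
      exists T : {fset R * {mset nat} * bool},
        (forall u, Omega_w eps w u ->
           delta_that that w k u =
           invmx (H g0 g (that u) u) *m
             \sum_(t <- T) t.1.1 *: tau g0 g that w t.1.2 t.2 u) /\
        (forall (a : R) (K : {mset nat}) (omega : bool), (a, K, omega) \in T ->
           [/\ forall k', k' \in K -> (0 < k')%N,
               forall k', k' \in K -> (k' < k)%N
             & (omega + \sum_(k' <- K) k' = k)%N])].
Proof.
move=> _ D_gt0 kIJ_gt0 eps_gt0 root Wo [e e_gt0 tube_e] Cg0 Cg spd opn boundM boundd
  /andP[_ rho1] small.
have Uo : open (Omega_w eps w) := @open_Omega_w _ _ _ _.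
have U1 : Omega_w eps w (ones N) := ones_Omega_w w eps_gt0.
(* converts the Euclidean tube into one for the sup norm *)
pose e' := e / D.+1%:R.
have e'_gt0 : 0 < e' by rewrite divr_gt0.
have tube u1 u2 (t : R) z : Omega_w eps w u1 -> Omega_w eps w u2 -> 0 <= t <= 1 ->
    `|z| < e' -> Omega_theta (t *: that u1 + (1 - t) *: that u2 + z).
  move=> U_u1 U_u2 t01 ze.
  apply: (tube_e _ (t *: that u1 + (1 - t) *: that u2)).
    by apply: convex_hull_segment => //; exists u1 || exists u2.
  rewrite addrAC subrr add0r; apply: le_lt_trans (enorm_le_norm _) _.
  move: ze; rewrite /e' ltr_pdivlMr //; apply: le_lt_trans.
  by rewrite mulrC ler_wpM2l // ler_nat.
have Wthat := W_that e'_gt0 tube.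
have W1 := Wthat _ U1.
(* D > 0 provides a nonzero vector on which to test the coercivity at 1 *)
have Cop_gt0 : 0 < Cop.
  have x0 : const_mx 1 != 0 :> 'cV[R]_D.
    apply/eqP => /colP /(_ (Ordinal D_gt0)); rewrite !mxE => /eqP.
    by rewrite oner_eq0.
  have := inverse_bound_coercive (const_mx 1) (spd _ W1) (opn _ W1).
  move/(lt_le_trans (dotp_gt0 x0)); rewrite pmulr_lgt0 //.
  exact: (spd _ W1).2 _ x0.
have M2_ge0 : 0 <= M 2%N.
  by apply: le_trans (boundM 2%N _ _ W1); [exact: sqrtr_ge0 | rewrite /= ltnS].
have d0_ge0 : 0 <= delta 0%N.
  by apply: le_trans (boundd 0%N _ _ _ U1 W1); [exact: sqrtr_ge0 | ].
(* the second summand of the smallness condition is nonnegative *)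
have Cd : Cop * delta 1%N <= rho.
  apply: le_trans small; rewrite lerDl mulr_ge0 // mulr_ge0 // exprn_ge0 //.
  exact: ltW.
(* the constant of strong monotonicity *)
pose c := (1 - rho) / Cop.
have c_gt0 : 0 < c by rewrite divr_gt0 // subr_gt0.
have coercive theta u x : Omega_theta theta -> Omega_w eps w u ->
    c * dotp x x <= (x^T *m H g0 g theta u *m x) 0 0.
  move=> Wt Uu.
  have fr : frobenius (H g0 g theta u - H g0 g theta (ones N)) <= delta 1%N.
    by rewrite frobenius_H; exact: boundd.
  have := quadratic_perturbation (ltW Cop_gt0)
    (inverse_bound_coercive x (spd _ Wt) (opn _ Wt)) fr Cd.
  by move=> qc; rewrite /c mulrAC ler_pdivrMr // [leRHS]mulrC.
have Hu : forall u, Omega_w eps w u -> H g0 g (that u) u \in unitmx.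
  exact: (H_unitmx c_gt0 coercive e'_gt0 tube).
have Cthat : Ck_on kIJ.+1 (Omega_w eps w) that.
  exact: (Ck_on_that Wo (ltn0Sn kIJ) Cg0 Cg Uo root c_gt0 coercive e'_gt0 tube).
split=> // k /andP[k_gt0 k_le].
have kK : (0 < k <= kIJ.+1)%N by rewrite k_gt0.
have [T [TE Tg]] :=
  directional_expansion w Wo Uo (ltn0Sn kIJ) Cg0 Cg root Wthat Cthat kK.
have [F [FE Fk]] :=
  aggregate_terms [seq (t.1.1, seq_mset t.1.2, t.2) | t <- T].
exists F; split=> [u Uu|a K omega].
  rewrite (FE _ (fun K omega => tau g0 g that w K omega u)) big_map /=.
  apply: (canRL (mulKmx (Hu u Uu))); rewrite TE // big_seq [RHS]big_seq.
  apply: eq_bigr => t tT; rewrite /term_value; congr (_ *: _).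
  have sz : (size t.1.2 <= kIJ.+1)%N := leq_trans (graded_size (Tg t tT)) k_le.
  have pm := perm_eq_seq_mset t.1.2.
  rewrite (tauE w Wo Cg0 Cg Wthat) //; last by rewrite (perm_size pm).
  by rewrite (perm_tau_seq w Wo Cg0 Cg Wthat _ Uu _ pm) // (perm_size pm).
move=> /Fk /mapP[_ /mapP[t tT ->] /= [-> ->]].
have /andP[/allP ak /eqP sk] := Tg t tT.
have pm := perm_eq_seq_mset t.1.2.
split=> [k'|k'|].
- by rewrite (perm_mem pm) => /ak /andP[].
- by rewrite (perm_mem pm) => /ak /andP[].
- by rewrite (perm_big _ pm) /= -sumnE.
Qed.
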